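(* Let $\mathcal P_t=e^{t\mathcal L}$ be a primitive quantum Markov semigroup satisfying the $\sigma$-GNS detailed balance condition for its full-rank invariant state $\sigma$, and let $\sigma_{\min}$ be the smallest eigenvalue of $\sigma$. Then for every $p\in(1,2]$, $$\alpha_p(\mathcal L)\ \ge\ \max\Big\{\frac{1}{2p\,(2-\log\sigma_{\min})},\ \frac{p-1}{p}\Big\}\,\lambda(\mathcal L),$$ where $\alpha_p(\mathcal L)$ is the optimal constant in the $p$-Beckner inequality and $\lambda(\mathcal L)$ is the Poincaré constant (spectral gap).
   Context: $\mathcal H$ is a finite-dimensional Hilbert space, $\mathcal B(\mathcal H)$ the operators on it, $\mathbf 1$ the identity. A quantum Markov semigroup (QMS) is a $C_0$-semigroup $(\mathcal P_t)_{t\ge0}$ of completely positive unital maps on $\mathcal B(\mathcal H)$, with generator $\mathcal L$; $\dagger$ is the adjoint for the Hilbert–Schmidt inner product. It is primitive if it has a unique invariant state $\sigma$ ($\mathcal P_t^\dagger(\sigma)=\sigma$ for all $t$) and $\sigma$ has full rank. The $\sigma$-GNS detailed balance condition means that $\mathcal L$ is self-adjoint for $\langle X,Y\rangle_{\sigma,1}=\mathrm{Tr}(\sigma X^*Y)$. Put $\langle X,Y\rangle_{\sigma,1/2}=\mathrm{Tr}(\sigma^{1/2}X^*\sigma^{1/2}Y)$. Let $\Gamma_\sigma^{s}(X)=\sigma^{s/2}X\sigma^{s/2}$ for $s\in\mathbb R$, $\|X\|_{p,\sigma}=\mathrm{Tr}\big(|\Gamma_\sigma^{1/p}(X)|^p\big)^{1/p}$,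 $\hat p=p/(p-1)$, and for $X>0$ $$\mathcal E_{p,\mathcal L}(X)=-\frac{\hat p\,p}{4}\Big\langle \Gamma_\sigma^{-1/\hat p}\big((\Gamma_\sigma^{1/p}(X))^{p-1}\big),\mathcal L(X)\Big\rangle_{\sigma,1/2}.$$ The $p$-Beckner inequality with constant $\alpha_p$ is $\alpha_p\,\hat p\,(\|X\|_{p,\sigma}^p-\|X\|_{1,\sigma}^p)\le\mathcal E_{p,\mathcal L}(X)$ for all $X>0$, and $\alpha_p(\mathcal L)$ is the largest such constant. The Poincaré constant is $$\lambda(\mathcal L)=\inf_{X\in\mathcal B(\mathcal H),\,X\notin\mathbb C\mathbf 1}\frac{-\langle X,\mathcal L X\rangle_{\sigma,1/2}}{\|X-\mathrm{Tr}(\sigma X)\mathbf 1\|_{2,\sigma}^2}.$$ *)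

(* Defs.v *)
From HB Require Import structures.
From mathcomp Require Import all_boot all_order all_algebra.
From mathcomp Require Import complex.
From mathcomp Require Import all_classical all_reals all_analysis.
Set Implicit Arguments.
Unset Strict Implicit.
Unset Printing Implicit Defensive.
Import Order.TTheory GRing.Theory Num.Theory.
Import numFieldNormedType.Exports.
Local Open Scope classical_set_scope.
Local Open Scope ring_scope.
Local Open Scope complex_scope.
Local Open Scope sesquilinear_scope.

(* The Hilbert space is C^n with C = R[i], and operators are n x n matrices.
   [X ^t*] is the conjugate transpose.  The order of R[i] is
   z <= z' iff 'Im z = 'Im z' and 'Re z <= 'Re z'. *)

Section Positivity.
Context {R : realType}.

(* [0 <= z] in R[i] forces [z] to be real, so both predicates imply that the
   matrix is Hermitian. *)
Definition psdmx n (A : 'M[R[i]]_n) : Prop :=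
  forall v : 'cV[R[i]]_n, 0 <= (v ^t* *m A *m v) 0 0.

Definition posdefmx n (A : 'M[R[i]]_n) : Prop :=
  forall v : 'cV[R[i]]_n, v != 0 -> 0 < (v ^t* *m A *m v) 0 0.

Definition completely_positive n (Phi : 'M[R[i]]_n -> 'M[R[i]]_n) : Prop :=
  forall (k : nat) (A : 'I_k -> 'I_k -> 'M[R[i]]_n),
    psdmx (\mxblock_(i < k, j < k) A i j) ->
    psdmx (\mxblock_(i < k, j < k) Phi (A i j)).

End Positivity.

Section HilbertSchmidt.
Context {R : realType} {n : nat}.
Implicit Types X Y : 'M[R[i]]_n.

Definition hs_inner X Y : R[i] := \tr (X ^t* *m Y).

Definition hs_adjoint (Phi : 'M[R[i]]_n -> 'M[R[i]]_n) Y : 'M[R[i]]_n :=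
  \matrix_(i, j) Num.conj (hs_inner Y (Phi (delta_mx i j))).

Lemma hs_adjointP (Phi : {linear 'M[R[i]]_n -> 'M[R[i]]_n}) X Y :
  hs_inner (hs_adjoint Phi Y) X = hs_inner Y (Phi X).
Proof.
transitivity (\sum_i \sum_j X i j * hs_inner Y (Phi (delta_mx i j))).
  rewrite {1}/hs_inner /mxtrace; under eq_bigr do rewrite mxE.
  rewrite exchange_big /=; apply: eq_bigr => i _; apply: eq_bigr => j _.
  by rewrite !mxE conjCK mulrC.
rewrite [in RHS](matrix_sum_delta X) raddf_sum /hs_inner mulmx_sumr raddf_sum /=.
apply: eq_bigr => i _; rewrite raddf_sum mulmx_sumr raddf_sum /=.
by apply: eq_bigr => j _; rewrite linearZ /= -scalemxAr mxtraceZ.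
Qed.

End HilbertSchmidt.

Section QuantumMarkovSemigroup.
Context {R : realType} {n : nat}.

(* The cast to [numClosedFieldType] selects the topology of R[i] given by its
   modulus, hence the entrywise topology on matrices. *)
Local Notation C := (R[i] : numClosedFieldType).

Record is_qms (P : R -> 'M[R[i]]_n -> 'M[R[i]]_n) : Prop := {
  qms_linear : forall t, 0 <= t -> linear (P t) ;
  qms_cp : forall t, 0 <= t -> completely_positive (P t) ;
  qms_unital : forall t, 0 <= t -> P t 1%:M = 1%:M ;
  qms_id : forall X, P 0 X = X ;
  qms_semigroup : forall s t X, 0 <= s -> 0 <= t -> P (s + t) X = P s (P t X) ;
  qms_continuous : forall X : 'M[C]_n, P t X @[t --> 0^'+] --> X }.

(* In finite dimension the generator is defined on all operators. *)
Definition is_generator (P : R -> 'M[R[i]]_n -> 'M[R[i]]_n)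
    (L : 'M[R[i]]_n -> 'M[R[i]]_n) : Prop :=
  forall X : 'M[C]_n,
    (t^-1)%:C *: (P t X - X) @[t --> 0^'+] --> (L X : 'M[C]_n).

Definition is_state (rho : 'M[R[i]]_n) : Prop := psdmx rho /\ \tr rho = 1.

Definition invariant_state (P : R -> 'M[R[i]]_n -> 'M[R[i]]_n)
    (rho : 'M[R[i]]_n) : Prop :=
  is_state rho /\ forall t, 0 <= t -> hs_adjoint (P t) rho = rho.

Definition primitive_for (P : R -> 'M[R[i]]_n -> 'M[R[i]]_n)
    (sigma : 'M[R[i]]_n) : Prop :=
  [/\ invariant_state P sigma,
      forall rho, invariant_state P rho -> rho = sigma &
      \rank sigma = n].

Definition smallest_eigenvalue (A : 'M[R[i]]_n) (s : R) : Prop :=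
  eigenvalue A s%:C /\ forall z, eigenvalue A z -> s%:C <= z.

End QuantumMarkovSemigroup.

Section NoncommutativeLp.
Context {R : realType} {n : nat}.
Implicit Types sigma X Y : 'M[R[i]]_n.

(* Functional calculus of a Hermitian matrix, by the library's unitary
   diagonalization [orthomx_spectralP]. *)
Definition mxfun (f : R -> R) X : 'M[R[i]]_n :=
  invmx (spectralmx X)
    *m diag_mx (map_mx (fun z => (f (complex.Re z))%:C) (spectral_diag X))
    *m spectralmx X.

Definition mxpow X (r : R) : 'M[R[i]]_n := mxfun (fun x => x `^ r) X.

Definition mxabs X : 'M[R[i]]_n := mxpow (X ^t* *m X) (1 / 2).

Definition gns_inner sigma X Y : R[i] := \tr (sigma *m X ^t* *m Y).

Definition kms_inner sigma X Y : R[i] :=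
  \tr (mxpow sigma (1 / 2) *m X ^t* *m mxpow sigma (1 / 2) *m Y).

Definition gns_detailed_balance sigma (L : 'M[R[i]]_n -> 'M[R[i]]_n) : Prop :=
  forall X Y, gns_inner sigma (L X) Y = gns_inner sigma X (L Y).

Definition Gamma sigma (s : R) X : 'M[R[i]]_n :=
  mxpow sigma (s / 2) *m X *m mxpow sigma (s / 2).

Definition normp sigma (p : R) X : R :=
  (complex.Re (\tr (mxpow (mxabs (Gamma sigma (1 / p) X)) p))) `^ (1 / p).

End NoncommutativeLp.

Section BecknerPoincare.
Context {R : realType} {n : nat}.
Variables (sigma : 'M[R[i]]_n) (L : 'M[R[i]]_n -> 'M[R[i]]_n).

Definition hat (p : R) : R := p / (p - 1).

(* The inner product is real: for positive definite [X], both arguments are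
   Hermitian when [L] preserves adjoints. *)
Definition beckner_energy (p : R) (X : 'M[R[i]]_n) : R :=
  - (hat p * p / 4)
  * complex.Re (kms_inner sigma
      (Gamma sigma (- (1 / hat p)) (mxpow (Gamma sigma (1 / p) X) (p - 1)))
      (L X)).

Definition beckner (p alpha : R) : Prop :=
  forall X : 'M[R[i]]_n, posdefmx X ->
    alpha * hat p * (normp sigma p X `^ p - normp sigma 1 X `^ p)
      <= beckner_energy p X.

(* Extended-real valued: for n = 1 both sides of the Beckner inequality vanish
   and there is no nonscalar matrix, so both constants are +oo. *)
Definition beckner_constant (p : R) : \bar R :=
  ereal_sup [set alpha%:E | alpha in [set alpha | beckner p alpha]].

(* The inner product is real when [L] satisfies detailed balance. *)
Definition poincare_constant : \bar R :=
  ereal_inf [set (- complex.Re (kms_inner sigma X (L X))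
                  / normp sigma 2 (X - (\tr (sigma *m X))%:M) ^+ 2)%:E
            | X in [set X : 'M[R[i]]_n | ~~ is_scalar_mx X]].

End BecknerPoincare.

(* Main.v *)
Require Import Defs.
From HB Require Import structures.
From mathcomp Require Import all_boot all_order all_algebra.
From mathcomp Require Import complex.
From mathcomp Require Import all_classical all_reals all_analysis.
From mathcomp Require Import ring lra.
Set Implicit Arguments.
Unset Strict Implicit.
Unset Printing Implicit Defensive.
Import Order.TTheory GRing.Theory Num.Theory.
Import numFieldNormedType.Exports.
Local Open Scope ring_scope.
Local Open Scope complex_scope.
Local Open Scope sesquilinear_scope.

(** Write [Y] for [Gamma^(1/p) X] and [tau = Y^p], an unnormalized state. The
    Beckner energy and the Dirichlet form of [Z = Gamma^(-1/2) (tau^(1/2))] are,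
    up to the negative factors [- p^2 / (4 (p-1))] and [-1], values of one form
      [F t = tr (tau^(1-t) Gamma^t (L (Gamma^(-t) (tau^t))))],
    at [t = 1/p] and at [t = 1/2] respectively.

    Detailed balance with respect to the GNS product makes [L] commute with the
    modular group of [sigma], so in the eigenbases of [sigma] and [tau] it splits
    over the Bohr frequencies [s_c / s_a]. Together with the conditional complete
    positivity of [L] this gives [sv_form_levy]: [F t = sum_j c_j x_j^t] with
    [x_j > 0] and [c_j >= 0] except possibly where [x_j = 1]. Moreover
    [F 0 = F 1 = 0] since [L 1 = 0], and [F (1-t) = F t] by reversibility. Hence
    the elementary inequality
      [1 + x - x^t - x^(1-t) >= 4 t (1-t) (1 + x - 2 sqrt x)],
    which amounts to [sinh (u z) <= u sinh z], sums up to the Stroock-Varopoulos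
    inequality [- F t >= 4 t (1-t) (- F (1/2))] ([stroock_varopoulos]). At
    [t = 1/p] it says that the Beckner energy of [X] dominates the Dirichlet form
    of [Z], and the Poincare inequality bounds the latter below by
    [lambda (tr tau - (tr (sigma^(1/2) tau^(1/2)))^2)].

    What is left compares the states [sigma] and [tau] only: the Beckner
    functional is [tr tau - (tr (sigma^(1-1/p) tau^(1/p)))^p]. The squared
    overlaps of the two eigenbases turn every trace [tr (sigma^(1-t) tau^t)] into
    a moment [E f^t] of one classical density [f <= 1 / sigma_min]. The constant
    [(p-1)/p] comes from Jensen's inequality
      [(E f^(1/2))^2 <= (E f^(1/p))^p].
    The constant with [sigma_min] comes from bounding the Beckner functional by
    [(p-1)] times the relative entropy, and the entropy by [2 + ln (1/sigma_min)]
    times the squared Hellinger distance ([entropy_le_hellinger]), which in turn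
    is at most twice the variance. *)

(** * Scalar inequalities *)

Section Scalar.
Context {R : realType}.
Implicit Types (f df : R -> R) (u x z s g p : R).

Lemma ge0_of_derive_ge0 f df : (forall x, is_derive x 1 f (df x)) ->
  (forall x, 0 <= x -> 0 <= df x) -> 0 <= f 0 -> forall x, 0 <= x -> 0 <= f x.
Proof.
move=> fdf df0 f0 x; rewrite le_eqVlt => /orP[/eqP<-//|x0].
have [c + E] : exists2 c, c \in `]0, x[%R & f x - f 0 = df c * (x - 0).
  by apply: MVT => //; apply: derivable_within_continuous => y _; case: (fdf y).
rewrite in_itv/= => /andP[/ltW/df0 c0 _].
by rewrite -(subrK (f 0) (f x)) E subr0 addr_ge0// mulr_ge0// ltW.
Qed.

Lemma is_derive_expR_scale u x :
  is_derive x 1 (fun z => expR (u * z)) (u * expR (u * x)).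
Proof.
have h : is_derive x 1 (fun z : R => u * z) u.
  have -> : (fun z : R => u * z) = (u \*: (@id R))%R by apply/funext.
  by apply: is_derive_eq; rewrite /GRing.scale/= mulr1.
by apply: is_derive_eq; rewrite mulrC.
Qed.

(** Twice the hyperbolic functions, to keep denominators away. *)
Definition sinh2 z := expR z - expR (- z).
Definition cosh2 z := expR z + expR (- z).

Lemma is_derive_sinh2_scale u x :
  is_derive x 1 (fun z => sinh2 (u * z)) (u * cosh2 (u * x)).
Proof.
rewrite /sinh2 /cosh2.
have -> : (fun z => expR (u * z) - expR (- (u * z))) =
    (fun z => expR (u * z)) - (fun z => expR (- u * z)).
  by apply/funext => z; rewrite -mulNr.
have h1 := is_derive_expR_scale u x; have h2 := is_derive_expR_scale (- u) x.
by apply: is_derive_eq; rewrite !mulNr opprK mulrDr.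
Qed.

Lemma is_derive_cosh2_scale u x :
  is_derive x 1 (fun z => cosh2 (u * z)) (u * sinh2 (u * x)).
Proof.
rewrite /sinh2 /cosh2.
have -> : (fun z => expR (u * z) + expR (- (u * z))) =
    (fun z => expR (u * z)) + (fun z => expR (- u * z)).
  by apply/funext => z; rewrite -mulNr.
have h1 := is_derive_expR_scale u x; have h2 := is_derive_expR_scale (- u) x.
by apply: is_derive_eq; rewrite !mulNr mulrBr.
Qed.

Lemma sinh2_ge0 z : 0 <= z -> 0 <= sinh2 z.
Proof. by move=> z0; rewrite subr_ge0 ler_expR; lra. Qed.

Lemma le_cosh2_scale u z : 0 <= u <= 1 -> 0 <= z -> cosh2 (u * z) <= cosh2 z.
Proof.
move=> /andP[u0 u1] z0; rewrite -subr_ge0 /cosh2.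
have -> : expR z + expR (- z) - (expR (u * z) + expR (- (u * z))) =
    (expR z - expR (u * z)) * (1 - expR (- (z + u * z))).
  rewrite mulrBr mulr1 mulrBl -!expRD.
  by rewrite (_ : z + _ = - (u * z)) 1?(_ : u * z + _ = - z); ring.
have uzz : u * z <= z by rewrite ler_piMl.
rewrite mulr_ge0// subr_ge0 ?ler_expR// expR_le1.
by rewrite oppr_le0 addr_ge0// mulr_ge0.
Qed.

(** Convexity of [sinh] on the positive half-line; squared, it says that
    [(cosh (u c) - 1) / u^2] is largest at [u = 1]. *)
Lemma sinh2_scale_le u z : 0 <= u <= 1 -> 0 <= z ->
  sinh2 (u * z) <= u * sinh2 z.
Proof.
move=> u01 z0; rewrite -subr_ge0; move: z z0.
apply: (@ge0_of_derive_ge0 (fun z => u * sinh2 z - sinh2 (u * z))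
  (fun z => u * cosh2 z - u * cosh2 (u * z))).
- move=> x; have h1 := is_derive_sinh2_scale u x.
  have := is_derive_sinh2_scale 1 x; under eq_fun do rewrite mul1r.
  rewrite !mul1r => h2.
  have h3 : is_derive x 1 (fun z => u * sinh2 z) (u * cosh2 x).
    have -> : (fun z => u * sinh2 z) = (u \*: sinh2)%R by apply/funext.
    by apply: is_derive_eq.
  by apply: is_derive_eq.
- move=> x x0; rewrite -mulrBr mulr_ge0 ?subr_ge0 ?le_cosh2_scale//.
  by case/andP: u01.
- by rewrite mulr0 /sinh2 oppr0 subrr mulr0 subrr.
Qed.

Lemma sinh2N z : sinh2 (- z) = - sinh2 z.
Proof. by rewrite /sinh2 opprK opprB. Qed.

Lemma sqr_sinh2_scale_le u z : 0 <= u <= 1 ->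
  sinh2 (u * z) ^+ 2 <= u ^+ 2 * sinh2 z ^+ 2.
Proof.
move=> u01.
wlog z0 : z / 0 <= z => [H|].
  have [/H//|/ltW z0] := leP 0 z.
  by have := H (- z); rewrite oppr_ge0 mulrN !sinh2N !sqrrN; apply.
rewrite -exprMn ler_pXn2r ?sinh2_scale_le// nnegrE; last first.
  by case/andP: u01 => u0 _; rewrite mulr_ge0// sinh2_ge0.
by case/andP: u01 => u0 _; rewrite sinh2_ge0// mulr_ge0.
Qed.

(** A jump of frequency [x] contributes [1 + x - x^s - x^(1-s)] to the defect of
    the form at exponent [s]; the kernel compares it with exponent [1/2]. *)
Definition sv_kernel s x : R :=
  1 + x - x `^ s - x `^ (1 - s) - 4 * s * (1 - s) * (1 + x - 2 * x `^ (1 / 2)).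

(** With [x = expR (4 * z)] the kernel is, up to the factor [expR (2 * z)], the
    defect of [sqr_sinh2_scale_le] at [u = 2 * s - 1]. *)
Lemma sv_kernel_ge0 s x : 1 / 2 <= s <= 1 -> 0 < x -> 0 <= sv_kernel s x.
Proof.
move=> /andP[s1 s2] x0; pose z := ln x / 4; pose u := 2 * s - 1.
have powE t : x `^ t = expR (2 * z) * expR ((2 * t - 1) * (2 * z)).
  by rewrite -expRD /powR gt_eqF//; congr expR; rewrite /z; field.
have -> : sv_kernel s x =
    expR (2 * z) * (u ^+ 2 * sinh2 z ^+ 2 - sinh2 (u * z) ^+ 2).
  have sqE (v : R) : expR (2 * v) = expR v ^+ 2 by rewrite -expRM_natl.
  have x1 : x = (expR z ^+ 2) ^+ 2.
    rewrite -[LHS](@powRr1 _ x) ?ltW// powE -expRD -2!sqE; congr expR; ring.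
  have xs : x `^ s = expR z ^+ 2 * expR (u * z) ^+ 2.
    by rewrite powE -!sqE; congr (_ * expR _); rewrite /u; ring.
  have xs' : x `^ (1 - s) = expR z ^+ 2 * expR (- (u * z)) ^+ 2.
    by rewrite powE -!sqE; congr (_ * expR _); rewrite /u; ring.
  have x2 : x `^ (1 / 2) = expR z ^+ 2.
    by rewrite powE -!sqE -expRD; congr expR; field.
  have u2 : 4 * s * (1 - s) = 1 - u ^+ 2 by rewrite /u; ring.
  have := expRxMexpNx_1 (u * z); have := expRxMexpNx_1 z.
  rewrite /sv_kernel xs xs' x2 u2 {}x1 sqE /sinh2 {s1 s2 powE xs xs' x2 u2}.
  move: @u (expR z) (expR (- z)) (expR (u * z)) (expR (- (u * z))).
  move=> v E E' G G' EE' GG'.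
  have -> : E ^+ 2 * (v ^+ 2 * (E - E') ^+ 2 - (G - G') ^+ 2) =
    v ^+ 2 * (E ^+ 2 - E * E') ^+ 2 - E ^+ 2 * (G ^+ 2 + G' ^+ 2 - 2 * (G * G')).
    by ring.
  rewrite EE' GG'; ring.
rewrite mulr_ge0 ?expR_ge0// subr_ge0 sqr_sinh2_scale_le// /u; lra.
Qed.

Lemma sv_kernel1 s : sv_kernel s 1 = 0.
Proof. by rewrite /sv_kernel !powR1; ring. Qed.

End Scalar.

Section Entropy.
Context {R : realType}.
Implicit Types (x g a M : R).

Lemma ln_le_subr1 x : 0 < x -> ln x <= x - 1.
Proof. by move=> x0; have := @le_ln1Dx R (x - 1); rewrite subrKC; apply; lra. Qed.

Lemma cosh2_ge2 x : 2 <= cosh2 x.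
Proof.
have := expRxMexpNx_1 x; have := sqr_ge0 (expR x - expR (- x)).
have := expR_gt0 x; have := expR_gt0 (- x); rewrite /cosh2; nra.
Qed.

Lemma sinh2_ge x : 0 <= x -> 2 * x <= sinh2 x.
Proof.
move=> x0; rewrite -subr_ge0; move: x x0.
apply: (@ge0_of_derive_ge0 _ (fun z => sinh2 z - 2 * z) (fun z => cosh2 z - 2)).
- move=> x; have := is_derive_sinh2_scale 1 x; under eq_fun do rewrite mul1r.
  rewrite !mul1r => h1.
  have h2 : is_derive x 1 (fun z : R => 2 * z) 2.
    have -> : (fun z : R => 2 * z) = (2 \*: (@id R))%R by apply/funext.
    by apply: is_derive_eq; rewrite /GRing.scale/= mulr1.
  by apply: is_derive_eq.
- by move=> x _; rewrite subr_ge0 cosh2_ge2.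
- by rewrite /sinh2 oppr0 mulr0 !subrr.
Qed.

Lemma sinh2_le_mul_cosh2 x : 0 <= x -> sinh2 x <= x * cosh2 x.
Proof.
move=> x0; rewrite -subr_ge0; move: x x0.
apply: (@ge0_of_derive_ge0 _ (fun z => z * cosh2 z - sinh2 z)
  (fun z => z * sinh2 z)).
- move=> x; have := is_derive_sinh2_scale 1 x; under eq_fun do rewrite mul1r.
  rewrite !mul1r => h1.
  have := is_derive_cosh2_scale 1 x; under eq_fun do rewrite mul1r.
  rewrite !mul1r => h2.
  have h3 : is_derive x 1 (fun z => z * cosh2 z) (x * sinh2 x + cosh2 x).
    have -> : (fun z => z * cosh2 z) = (@id R) * cosh2 by apply/funext.
    by apply: is_derive_eq; rewrite /GRing.scale/= mulr1.
  by apply: is_derive_eq; rewrite addrK.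
- by move=> x x0; rewrite mulr_ge0// sinh2_ge0.
- by rewrite mul0r /sinh2 oppr0 !subrr.
Qed.

(** This is [y <= sinh y] at [y = ln g]. *)
Lemma ln_le_half_subV g : 1 <= g -> ln g <= (g - g^-1) / 2.
Proof.
move=> g1; have g0 : 0 < g by lra.
have := sinh2_ge (ln_ge0 g1); rewrite /sinh2 expRN lnK ?posrE//.
by rewrite ler_pdivlMr// mulrC.
Qed.

(** This is [tanh v <= v] at [v = - ln g / 2]. *)
Lemma ln_le_pade g : 0 < g <= 1 -> ln g * (g + 1) <= 2 * (g - 1).
Proof.
move=> /andP[g0 g1]; pose v := - ln g / 2.
have v0 : 0 <= v by rewrite divr_ge0// oppr_ge0 ln_le0.
have := sinh2_le_mul_cosh2 v0; rewrite /sinh2 /cosh2.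
have -> : ln g = - (2 * v) by rewrite /v; field.
have : g = expR (- v) ^+ 2.
  by rewrite -expRM_natl -[LHS]lnK ?posrE//; congr expR; rewrite /v; field.
have := expRxMexpNx_1 v; have := expR_gt0 (- v); have := expR_gt0 v.
move: (expR v) (expR (- v)) v0 => E E'; move: v => v v0 E0 E'0 EE' -> H.
have : E' * (E - E') <= E' * (v * (E + E')) by rewrite ler_pM2l.
have -> : E' * (E - E') = E * E' - E' ^+ 2 by ring.
have -> : E' * (v * (E + E')) = v * (E * E' + E' ^+ 2) by ring.
rewrite EE'; lra.
Qed.

(** Entropy against the squared Hellinger distance. Near [x = 1] both sides
    are quadratic with the same curvature when [M = 1], and the factor
    [2 + ln M] pays for the logarithm of large values. *)
Lemma entropy_le_hellinger x M : 0 < x <= M -> 1 <= M ->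
  x * ln x - x + 1 <= (2 + ln M) * (Num.sqrt x - 1) ^+ 2.
Proof.
move=> /andP[x0 xM] M1; have M0 := lt_le_trans x0 xM.
have := ln_ge0 M1; have : ln x <= ln M by rewrite ler_ln ?posrE.
have g0 : 0 < Num.sqrt x by rewrite sqrtr_gt0.
have := esym (sqr_sqrtr (ltW x0)).
move: (Num.sqrt x) (ln M) g0 => g l g0 ->; rewrite lnXn// mulr2n => gl l0.
have [g1|/ltW g1] := leP g 1.
  have g01 : 0 < g <= 1 by rewrite g0.
  have H1 := ln_le_pade g01.
  have : g ^+ 2 * (ln g * (g + 1)) <= g ^+ 2 * (2 * (g - 1)).
    by rewrite ler_pM2l// exprn_gt0.
  have H3 : 0 <= l * (g - 1) ^+ 2 by rewrite mulr_ge0// sqr_ge0.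
  move=> H2.
  suff : (g + 1) * (g ^+ 2 * (ln g + ln g) - g ^+ 2 + 1) <=
         (g + 1) * (2 * (g - 1) ^+ 2).
    by rewrite ler_pM2l; lra.
  have H4 : 0 <= (1 - g) * (g - 1) ^+ 2 by rewrite mulr_ge0 ?sqr_ge0//; lra.
  have -> : (g + 1) * (g ^+ 2 * (ln g + ln g) - g ^+ 2 + 1) =
     2 * (g ^+ 2 * (ln g * (g + 1))) + (g + 1) * (1 - g ^+ 2) by ring.
  nra.
have H1 := ln_le_half_subV g1.
have H2 : g * (ln g * (2 * g - 1)) <= g * ((g - g^-1) / 2 * (2 * g - 1)).
  by rewrite ler_pM2l// ler_pM2r//; lra.
have E : g * ((g - g^-1) / 2 * (2 * g - 1)) = (g ^+ 2 - 1) * (2 * g - 1) / 2.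
  by field; rewrite gt_eqF.
have H3 : (ln g + ln g) * (g - 1) ^+ 2 <= l * (g - 1) ^+ 2.
  by rewrite ler_wpM2r// sqr_ge0.
have H4 : 0 <= (g - 1) ^+ 3 by rewrite exprn_ge0//; lra.
suff : g * (g ^+ 2 * (ln g + ln g) - g ^+ 2 + 1) <=
       g * (2 * (g - 1) ^+ 2 + (ln g + ln g) * (g - 1) ^+ 2).
  by rewrite ler_pM2l//; lra.
move: H2; rewrite E; nra.
Qed.

(** Weighted inequality of arithmetic and geometric means for [x] and [1], from
    [ln t <= t - 1] at the two quotients by their arithmetic mean [y]. *)
Lemma bernoulli_powR x a : 0 < x -> 0 <= a <= 1 -> x `^ a <= 1 + a * (x - 1).
Proof.
move=> x0 /andP[a0 a1]; set y := 1 + _.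
have y0 : 0 < y by rewrite /y; have [?|?] := leP x 1; nra.
have h1 : a * ln (x / y) <= a * (x / y - 1).
  by rewrite ler_wpM2l// ln_le_subr1// divr_gt0.
have h2 : (1 - a) * ln (y^-1) <= (1 - a) * (y^-1 - 1).
  by rewrite ler_wpM2l ?subr_ge0// ln_le_subr1// invr_gt0.
rewrite /powR gt_eqF// -[leRHS](@lnK _ y) ?posrE// ler_expR.
move: h1 h2; rewrite ln_div ?posrE// lnV ?posrE//.
have E : a * (x / y - 1) + (1 - a) * (y^-1 - 1) = 0.
  by rewrite /y; field; rewrite -/y gt_eqF.
lra.
Qed.

End Entropy.

(** Nothing is known about the sign of the weight at [x_j = 1], but every kernel
    summed here vanishes there. *)
Lemma levy_comparison {R : realType} (J : finType) (c x : J -> R) (t : R) :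
  1 / 2 <= t <= 1 -> (forall j, 0 < x j) -> (forall j, x j != 1 -> 0 <= c j) ->
  \sum_j c j = 0 -> \sum_j c j * x j = 0 ->
  \sum_j c j * x j `^ (1 - t) = \sum_j c j * x j `^ t ->
  0 <= - \sum_j c j * x j `^ (1 / 2) /\
  4 * t * (1 - t) * - (\sum_j c j * x j `^ (1 / 2)) <= - \sum_j c j * x j `^ t.
Proof.
move=> t01 x0 c0 F0 F1 Ft.
have pos (f : R -> R) : (forall y, 0 < y -> 0 <= f y) -> f 1 = 0 ->
    0 <= \sum_j c j * f (x j).
  move=> f0 f1; apply: sumr_ge0 => j _.
  by have [->|/c0 ?] := eqVneq (x j) 1; rewrite ?f1 ?mulr0// mulr_ge0// f0.
pose H := \sum_j c j * x j `^ (1 / 2); pose Gt := \sum_j c j * x j `^ t.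
rewrite -/H -/Gt; split.
  have := pos (fun y => 1 + y - 2 * y `^ (1 / 2)).
  under eq_bigr do rewrite mulrBr mulrDr mulr1 mulrCA.
  rewrite sumrB big_split/= F0 F1 -mulr_sumr -/H => P.
  suff : 0 <= 0 + 0 - 2 * H by lra.
  apply: P => [y y0|]; last by rewrite powR1; ring.
  rewrite div1r powR12_sqrt ?(ltW y0)//.
  rewrite (_ : _ - _ = (1 - Num.sqrt y) ^+ 2) ?sqr_ge0//.
  by rewrite -{1}(sqr_sqrtr (ltW y0)); ring.
have := pos (sv_kernel t) (fun y => @sv_kernel_ge0 R t y t01) (sv_kernel1 t).
have -> : \sum_j c j * sv_kernel t (x j) =
    \sum_j c j + \sum_j c j * x j - \sum_j c j * x j `^ t
    - \sum_j c j * x j `^ (1 - t)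
    - 4 * t * (1 - t) * (\sum_j c j + \sum_j c j * x j - 2 * H).
  rewrite /H [2 * _]mulr_sumr -!(big_split, sumrB)/= mulr_sumr -sumrB/=.
  by apply: eq_bigr => j _; rewrite /sv_kernel; ring.
rewrite F0 F1 Ft -/Gt; lra.
Qed.


Section PowerMeans.
Context {R : realType} {K : finType}.
Variables (P : K -> R) (p : R).
Hypotheses (P0 : forall k, 0 <= P k) (P1 : \sum_k P k = 1) (p12 : 1 < p <= 2).
Implicit Types (f h : K -> R) (M : R).

Let p_gt0 : 0 < p. Proof. by case/andP: p12 => ? _; lra. Qed.
Let pV01 : 0 <= p^-1 <= 1.
Proof. by case/andP: p12 => ? _; rewrite invr_ge0 ltW//= invf_le1//; lra. Qed.

Lemma average_le f h : (forall k, f k <= h k) ->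
  \sum_k P k * f k <= \sum_k P k * h k.
Proof. by move=> fh; apply: ler_sum => k _; rewrite ler_wpM2l. Qed.

Lemma average_affine f a b :
  \sum_k P k * (a + b * f k) = a + b * \sum_k P k * f k.
Proof.
under eq_bigr do rewrite mulrDr mulrCA.
by rewrite big_split/= -mulr_suml P1 mul1r -mulr_sumr.
Qed.

Section Normalized.
Variable f : K -> R.
Hypotheses (f0 : forall k, 0 < f k) (f1 : \sum_k P k * f k = 1).
Let q := \sum_k P k * f k `^ p^-1.
Let m := \sum_k P k * f k `^ (1 / 2).

Let q_gt0 : 0 < q.
Proof.
have [k Pk] : exists k, 0 < P k.
  apply: contrapT => P'0; have := P1; rewrite big1 => [|k _].
    by move/eqP; rewrite eq_sym oner_eq0.
  apply/eqP; rewrite eq_le P0 andbT leNgt; apply/negP => Pk.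
  by apply: P'0; exists k.
rewrite /q (bigD1 k)//= ltr_pwDl ?mulr_gt0 ?powR_gt0//.
by rewrite sumr_ge0// => i _; rewrite mulr_ge0// powR_ge0.
Qed.

Let q_le1 : q <= 1.
Proof.
suff : q <= \sum_k P k * ((1 - p^-1) + p^-1 * f k).
  by rewrite average_affine f1; lra.
apply: average_le => k; apply: le_trans (bernoulli_powR (f0 k) pV01) _; lra.
Qed.

Let powR_q_le1 : q `^ p <= 1.
Proof.
have -> : 1 = 1 `^ p by rewrite powR1.
by rewrite ge0_ler_powR ?nnegrE//; apply: ltW.
Qed.

(** Jensen's inequality for the concave power [p / 2], obtained by averaging its
    tangent line at the mean [q] of [f^(1/p)]. *)
Let sqr_m_le : m ^+ 2 <= q `^ p.
Proof.
have q0' : 0 < q `^ (p / 2) by rewrite powR_gt0.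
have p2 : 0 <= p / 2 <= 1 by case/andP: p12 => ? ?; lra.
have : m / q `^ (p / 2) <= 1.
  have -> : m / q `^ (p / 2) = \sum_k P k * (f k `^ p^-1 / q) `^ (p / 2).
    rewrite /m mulr_suml; apply: eq_bigr => k _; rewrite -mulrA; congr (_ * _).
    rewrite powRM ?powR_ge0 ?invr_ge0 ?(ltW q_gt0)// -powRrM.
    rewrite -(@powR_inv1 _ q) ?(ltW q_gt0)// -powRrM mulN1r powRN; congr (_ `^ _ * _).
    by field; rewrite gt_eqF.
  apply: (@le_trans _ _ (\sum_k P k * ((1 - p / 2) + (p / 2 / q) * f k `^ p^-1))).
    apply: average_le => k; have fq : 0 < f k `^ p^-1 / q.
      by rewrite divr_gt0 ?powR_gt0.
    by apply: le_trans (bernoulli_powR fq p2) _; lra.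
  by rewrite average_affine -/q divfK ?gt_eqF//; lra.
rewrite ler_pdivrMr// mul1r => mq.
have -> : q `^ p = (q `^ (p / 2)) ^+ 2.
  by rewrite -powR_mulrn ?powR_ge0// -powRrM; congr (_ `^ _); field.
by rewrite ler_pXn2r// nnegrE ?sumr_ge0 ?powR_ge0// => k _; rewrite mulr_ge0 ?powR_ge0.
Qed.

(** The chain is [1 - q^p <= p (1 - q) <= (p-1) E (f ln f)], and the entropy is
    bounded by the Hellinger distance [E (sqrt f - 1)^2 = 2 (1 - m)]; finally
    [1 - m <= 1 - m^2] because [0 <= m <= 1]. *)
Let power_defect_le M : (forall k, f k <= M) -> 1 <= M ->
  1 - q `^ p <= 2 * (p - 1) * (2 + ln M) * (1 - m ^+ 2).
Proof.
move=> fM M1.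
have s1 : 1 - q `^ p <= p * (1 - q).
  have := bernoulli_powR (powR_gt0 p q_gt0) pV01.
  rewrite -powRrM mulfV ?gt_eqF// powRr1 ?(ltW q_gt0)// => H.
  suff : p * q <= p * (1 + p^-1 * (q `^ p - 1)).
    by rewrite mulrDr mulrA mulfV ?gt_eqF//; lra.
  by rewrite ler_pM2l.
(* Pointwise [p (f - f^(1/p)) <= (p - 1) f ln f], the tangent line of [expR] at 0;
   the means of [f] and of 1 agree, which allows the affine correction [1 - f]. *)
have s2 : p * (1 - q) <= (p - 1) * ((2 + ln M) * (2 * (1 - m))).
  have -> : p * (1 - q) = \sum_k P k * (p * (f k - f k `^ p^-1)).
    rewrite -{1}f1 /q -sumrB mulr_sumr.
    by apply: eq_bigr => k _; rewrite -mulrBr mulrCA.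
  have -> : (2 + ln M) * (2 * (1 - m)) =
      \sum_k P k * ((2 + ln M) * (Num.sqrt (f k) - 1) ^+ 2).
    have -> : 2 * (1 - m) = \sum_k P k * f k + (1 + (- 2) * m).
      by rewrite f1; ring.
    rewrite -average_affine -big_split mulr_sumr/=.
    apply: eq_bigr => k _; rewrite -mulrDr mulrCA; congr (_ * (_ * _)).
    rewrite div1r powR12_sqrt ?(ltW (f0 k))//.
    by rewrite -{1}(sqr_sqrtr (ltW (f0 k))); ring.
  apply: (@le_trans _ _ ((p - 1) * \sum_k P k * (f k * ln (f k) - f k + 1))).
    have -> : \sum_k P k * (f k * ln (f k) - f k + 1) = \sum_k P k * (f k * ln (f k)).
      under eq_bigr do rewrite -addrA mulrDr.
      rewrite big_split/= [X in _ + X](_ : _ = 0) ?addr0//.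
      transitivity (1 + (- 1) * \sum_k P k * f k); last by rewrite f1; ring.
      rewrite -average_affine; apply: eq_bigr => k _; congr (_ * _); ring.
    rewrite mulr_sumr; under [leRHS]eq_bigr do rewrite mulrCA.
    apply: average_le => k.
    have fE : f k `^ p^-1 = f k * expR (- ((1 - p^-1) * ln (f k))).
      rewrite /powR gt_eqF// -{2}(@lnK _ (f k)) ?posrE// -expRD.
      by congr expR; ring.
    have /(ler_wpM2l (ltW (f0 k))) := expR_ge1Dx (- ((1 - p^-1) * ln (f k))).
    rewrite -fE => H.
    have : p * (f k * (1 - (1 - p^-1) * ln (f k))) <= p * f k `^ p^-1.
      by rewrite ler_pM2l.
    have -> : p * (f k * (1 - (1 - p^-1) * ln (f k))) =
       p * f k - (p - p / p) * (f k * ln (f k)) by ring.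
    rewrite mulfV ?gt_eqF//; lra.
  rewrite ler_wpM2l//; first by case/andP: p12 => ? _; lra.
  apply: average_le => k; apply: entropy_le_hellinger => //.
  by rewrite f0 fM.
apply: le_trans s1 (le_trans s2 _).
have m0 : 0 <= m by rewrite sumr_ge0// => k _; rewrite mulr_ge0 ?powR_ge0.
have m1 : m <= 1.
  by rewrite -(@ler_pXn2r _ 2)// ?nnegrE// expr1n (le_trans sqr_m_le).
have c0 : 0 <= (p - 1) * (2 + ln M).
  by case/andP: p12 => ? _; have := ln_ge0 M1 => ?; apply: mulr_ge0; lra.
have -> : (p - 1) * ((2 + ln M) * (2 * (1 - m))) =
  (p - 1) * (2 + ln M) * (2 * (1 - m)) by ring.
have -> : 2 * (p - 1) * (2 + ln M) * (1 - m ^+ 2) =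
  (p - 1) * (2 + ln M) * (2 * (1 - m ^+ 2)) by ring.
rewrite ler_wpM2l//; have : 0 <= m * (1 - m) by rewrite mulr_ge0// subr_ge0.
lra.
Qed.

Lemma normalized_power_means M : (forall k, f k <= M) -> 1 <= M ->
  [/\ m ^+ 2 <= q `^ p, q `^ p <= 1 &
      1 - q `^ p <= 2 * (p - 1) * (2 + ln M) * (1 - m ^+ 2)].
Proof. by move=> fM M1; split => //; exact: power_defect_le. Qed.

End Normalized.

Lemma power_means h M (N := \sum_k P k * h k) (q := \sum_k P k * h k `^ p^-1)
    (m := \sum_k P k * h k `^ (1 / 2)) :
  (forall k, 0 < h k) -> 0 < N -> (forall k, h k <= M * N) -> 1 <= M ->
  [/\ m ^+ 2 <= q `^ p, q `^ p <= N &
      N - q `^ p <= 2 * (p - 1) * (2 + ln M) * (N - m ^+ 2)].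
Proof.
move=> h0 N0 hM M1; pose f k := h k / N.
have f0 k : 0 < f k by rewrite divr_gt0.
have f1 : \sum_k P k * f k = 1.
  by under eq_bigr do rewrite mulrA; rewrite -mulr_suml -/N mulfV ?gt_eqF.
have fM k : f k <= M by rewrite ler_pdivrMr.
have hE a : \sum_k P k * h k `^ a = N `^ a * \sum_k P k * f k `^ a.
  rewrite mulr_sumr; apply: eq_bigr => k _.
  rewrite mulrCA -powRM ?(ltW N0) ?(ltW (f0 k))//.
  by rewrite [N * _]mulrC /f divfK ?gt_eqF.
have [] := normalized_power_means f0 f1 fM M1.
rewrite /q /m !hE powRM ?powR_ge0//; last first.
  by rewrite sumr_ge0// => k _; rewrite mulr_ge0 ?powR_ge0.
rewrite -powRrM mulVf ?gt_eqF// powRr1 ?(ltW N0)// exprMn.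
rewrite div1r powR12_sqrt ?(ltW N0)// sqr_sqrtr ?(ltW N0)// -div1r.
move: (_ `^ p) (_ ^+ 2) => u v h1 h2 h3.
have h4 : N * (1 - u) <= N * (2 * (p - 1) * (2 + ln M) * (1 - v)).
  by rewrite ler_pM2l.
split; [by rewrite ler_pM2l | by rewrite ler_piMr// ltW | ].
by apply: le_trans (le_trans h4 _); lra.
Qed.

End PowerMeans.

(** * Adjoints, positivity and functional calculus *)

Section Adjoint.
Context {C : numClosedFieldType}.

Lemma adjmxM m n k (A : 'M[C]_(m, n)) (B : 'M[C]_(n, k)) :
  (A *m B)^t* = B^t* *m A^t*.
Proof. by rewrite trmx_mul map_mxM. Qed.

Lemma adjmxB m n (A B : 'M[C]_(m, n)) : (A - B)^t* = A^t* - B^t*.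
Proof. by apply/matrixP => i j; rewrite !mxE rmorphB. Qed.

Lemma adjmxZ m n (c : C) (A : 'M[C]_(m, n)) : (c *: A)^t* = Num.conj c *: A^t*.
Proof. by apply/matrixP => i j; rewrite !mxE rmorphM. Qed.

Lemma adjmx1 n : (1%:M : 'M[C]_n)^t* = 1%:M.
Proof. by rewrite trmx1 map_mx1. Qed.

Lemma adjmx_sum m n (I : finType) (A : I -> 'M[C]_(m, n)) :
  (\sum_i A i)^t* = \sum_i (A i)^t*.
Proof. by rewrite raddf_sum raddf_sum. Qed.

Lemma mxtrace_sum n (I : finType) (A : I -> 'M[C]_n) :
  \tr (\sum_i A i) = \sum_i \tr (A i).
Proof. exact: raddf_sum. Qed.

Lemma unitary_mul_adj n (U : 'M[C]_n) : U \is unitarymx -> U *m U^t* = 1%:M.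
Proof. by move/unitarymxP. Qed.

Lemma unitary_adj_mul n (U : 'M[C]_n) : U \is unitarymx -> U^t* *m U = 1%:M.
Proof. by move=> Uu; rewrite -invmx_unitary// mulVmx// unitarymx_unit. Qed.

Lemma mx11_trace (A : 'M[C]_1) : A 0 0 = \tr A.
Proof. by rewrite /mxtrace big_ord1. Qed.

End Adjoint.

Lemma mxtrace_form_scale (C : numClosedFieldType) n (a b c : C)
    (x y : 'cV[C]_n) (N : 'M[C]_n) :
  \tr ((a *: x)^t* *m (b *: N) *m (c *: y)) =
  Num.conj a * b * c * \tr (y *m x^t* *m N).
Proof.
rewrite adjmxZ -scalemxAl -scalemxAr -scalemxAr -!scalemxAl !mxtraceZ.
by rewrite -[in RHS]mulmxA [in RHS]mxtrace_mulC; ring.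
Qed.

Lemma mxtrace_sqr_sub (T : comPzRingType) n (A B : 'M[T]_n) (c : T) :
  \tr ((B - c *: A) *m (B - c *: A)) =
  \tr (B *m B) - 2 * c * \tr (A *m B) + c ^+ 2 * \tr (A *m A).
Proof.
rewrite mulmxBr !mulmxBl -!scalemxAl -!scalemxAr.
rewrite !linearB/=.
rewrite !mxtraceZ [\tr (B *m A)]mxtrace_mulC; ring.
Qed.

Lemma mxtrace_rotate6 (S : comPzRingType) n (A B C D E F : 'M[S]_n) :
  \tr (A *m B *m C *m (D *m E *m F)) = \tr (B *m (C *m D) *m (E *m (F *m A))).
Proof. by rewrite -!mulmxA mxtrace_mulC -!mulmxA. Qed.

Section FunctionalCalculus.
Context {R : realType} {n : nat}.
Implicit Types (A X : 'M[R[i]]_n) (d e : 'I_n -> R) (U V : 'M[R[i]]_n).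

Lemma conj_real_complex (x : R) : Num.conj x%:C = x%:C.
Proof. by apply: conj_Creal; rewrite complex_real. Qed.

Lemma ReZ (x : R) (z : R[i]) : complex.Re (x%:C * z) = x * complex.Re z.
Proof. by case: z => a b; rewrite /= mul0r subr0. Qed.

Lemma Re_sum (I : finType) (F : I -> R[i]) :
  complex.Re (\sum_i F i) = \sum_i complex.Re (F i).
Proof.
by apply: (big_morph (@complex.Re R)) => // -[a b] [c e].
Qed.

Lemma psd_entry_real (z : R[i]) : 0 <= z -> Num.conj z = z.
Proof. by move=> z0; apply: conj_Creal; apply: ger0_real. Qed.

Definition diagR d : 'M[R[i]]_n := diag_mx (\row_i (d i)%:C).

(** The spectral form of a Hermitian matrix: eigenvalues [d], and the adjoints of
    the rows of the unitary matrix [U] as eigenvectors. *)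
Definition unidiag U d : 'M[R[i]]_n := U^t* *m diagR d *m U.

Lemma adj_diagR d : (diagR d)^t* = diagR d.
Proof.
apply/matrixP => i j; rewrite !mxE eq_sym; case: eqVneq => [->|_] /=.
  by rewrite !mulr1n conj_real_complex.
by rewrite !mulr0n rmorph0.
Qed.

Lemma diagRM d e : diagR d *m diagR e = diagR (fun i => d i * e i).
Proof.
rewrite mulmx_diag; congr diag_mx.
by apply/rowP => i; rewrite !mxE rmorphM.
Qed.

Lemma diagR1 : diagR (fun=> 1) = 1%:M.
Proof. by apply/matrixP => i j; rewrite !mxE. Qed.

Lemma unidiag_adj U d : (unidiag U d)^t* = unidiag U d.
Proof. by rewrite /unidiag !adjmxM trmxCK adj_diagR mulmxA. Qed.

Lemma unidiag_mul U d e : U \is unitarymx ->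
  unidiag U d *m unidiag U e = unidiag U (fun i => d i * e i).
Proof.
move=> Uu; rewrite /unidiag !mulmxA -[_ *m U *m U^t*]mulmxA (unitary_mul_adj Uu).
by rewrite mulmx1 -[_ *m diagR d *m _]mulmxA diagRM.
Qed.

Lemma unidiag1 U : U \is unitarymx -> unidiag U (fun=> 1) = 1%:M.
Proof. by move=> Uu; rewrite /unidiag diagR1 mulmx1 unitary_adj_mul. Qed.

Lemma eq_unidiag U d e : d =1 e -> unidiag U d = unidiag U e.
Proof.
by move=> /funext ->.
Qed.

Lemma mxtrace_unidiag U d : U \is unitarymx ->
  \tr (unidiag U d) = (\sum_i d i)%:C.
Proof.
move=> Uu; rewrite /unidiag mxtrace_mulC mulmxA (unitary_mul_adj Uu) mul1mx.
by rewrite mxtrace_diag rmorph_sum; apply: eq_bigr => i _; rewrite mxE.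
Qed.

(** The entries of [V *m U^t*] vanish between different eigenvalues, so the
    result of the functional calculus does not depend on the diagonalization. *)
Lemma unidiag_inj U V d e (f : R -> R) : U \is unitarymx -> V \is unitarymx ->
  unidiag U d = unidiag V e ->
  unidiag U (f \o d) = unidiag V (f \o e).
Proof.
move=> Uu Vu E.
have comm g h : unidiag U g = unidiag V h <->
    (V *m U^t*) *m diagR g = diagR h *m (V *m U^t*).
  split => [H|H].
    have := congr1 (fun M => V *m M *m U^t*) H.
    rewrite /unidiag !mulmxA -[_ *m U *m U^t*]mulmxA.
    rewrite (unitary_mul_adj Uu) (unitary_mul_adj Vu).
    by rewrite mulmx1 mul1mx.
  have := congr1 (fun M => V^t* *m M *m U) H.
  rewrite /unidiag !mulmxA (unitary_adj_mul Vu) mul1mx.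
  by rewrite -!mulmxA (unitary_adj_mul Uu) mulmx1 !mulmxA.
apply/comm; move/comm: E; move: (V *m U^t*) => M E.
apply/matrixP => i j; have := congr1 (fun N : 'M[R[i]]_n => N i j) E.
rewrite !mul_mx_diag !mul_diag_mx !mxE /= => Eij.
have [-> | ne] := eqVneq (d j) (e i); first by rewrite mulrC.
suff -> : M i j = 0 by rewrite mul0r mulr0.
apply/eqP; move/eqP: Eij; rewrite mulrC -subr_eq0 -mulrBl mulf_eq0.
by rewrite -rmorphB fmorph_eq0 subr_eq0 (negbTE ne).
Qed.

Lemma hermitian_unidiag A : A^t* = A ->
  A = unidiag (spectralmx A) (fun i => complex.Re (spectral_diag A 0 i)).
Proof.
move=> Ah; have Aherm : A \is hermsymmx.
  by apply/is_hermitianmxP; rewrite expr0 scale1r Ah.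
have -> : unidiag (spectralmx A) (fun i => complex.Re (spectral_diag A 0 i)) =
    (spectralmx A)^t* *m diag_mx (spectral_diag A) *m spectralmx A.
  rewrite /unidiag /diagR.
  suff -> : \row_i (complex.Re (spectral_diag A 0 i))%:C = spectral_diag A by [].
  apply/rowP => i; rewrite mxE; apply: RRe_real.
  by have /mxOverP/(_ 0 i) := hermitian_spectral_diag_real Aherm.
rewrite -(invmx_unitary (spectral_unitarymx A)).
exact/orthomx_spectralP/hermitian_normalmx.
Qed.

Lemma mxfunE f A : mxfun f A =
  unidiag (spectralmx A) (fun i => f (complex.Re (spectral_diag A 0 i))).
Proof.
rewrite /mxfun (invmx_unitary (spectral_unitarymx A)) /unidiag /diagR.
suff -> : map_mx (fun z => (f (complex.Re z))%:C) (spectral_diag A) =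
  \row_i (f (complex.Re (spectral_diag A 0 i)))%:C by [].
by apply/rowP => i; rewrite !mxE.
Qed.

Lemma mxfun_unidiag f U d : U \is unitarymx ->
  mxfun f (unidiag U d) = unidiag U (f \o d).
Proof.
move=> Uu; have Ah := hermitian_unidiag (unidiag_adj U d).
by rewrite mxfunE (unidiag_inj f Uu _ Ah) ?spectral_unitarymx.
Qed.

Lemma mxpow_unidiag U d r : U \is unitarymx ->
  mxpow (unidiag U d) r = unidiag U (fun i => d i `^ r).
Proof. exact: mxfun_unidiag. Qed.

Lemma quad_unitary_diag U (D : 'rV[R[i]]_n) i (v := U^t* *m delta_mx i (0 : 'I_1)) :
  U \is unitarymx -> (v^t* *m (U^t* *m diag_mx D *m U) *m v) 0 0 = D 0 i.
Proof.
move=> Uu; rewrite /v adjmxM trmxCK !mulmxA.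
rewrite -[_ *m U *m U^t*]mulmxA (unitary_mul_adj Uu) mulmx1.
rewrite -[_ *m U *m U^t*]mulmxA (unitary_mul_adj Uu) mulmx1.
rewrite trmx_delta map_delta_mx -rowE -colE !mxE eqxx.
by rewrite mulr1n.
Qed.

Lemma quad_unidiag U d i (v := U^t* *m delta_mx i (0 : 'I_1)) :
  U \is unitarymx -> (v^t* *m unidiag U d *m v) 0 0 = (d i)%:C.
Proof. by move=> Uu; rewrite quad_unitary_diag// mxE. Qed.

(** The anti-Hermitian part is normal and its quadratic form vanishes, so all its
    eigenvalues are zero. *)
Lemma psdmx_adj A : psdmx A -> A^t* = A.
Proof.
move=> Apsd; pose H := A - A^t*.
have Hq (v : 'cV[R[i]]_n) : (v^t* *m H *m v) 0 0 = 0.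
  rewrite /H mulmxBr mulmxBl mxE [X in _ + X]mxE; apply/eqP.
  rewrite subr_eq0; apply/eqP; rewrite -[LHS]psd_entry_real ; last exact: Apsd.
  have <- : (v^t* *m A *m v)^t* 0 0 = Num.conj ((v^t* *m A *m v) 0 0).
    by rewrite !mxE.
  by rewrite !adjmxM trmxCK mulmxA.
have Hn : H \is normalmx.
  apply/normalmxP; rewrite /H adjmxB trmxCK -opprB.
  by rewrite mulNmx mulmxN.
suff H0 : H = 0 by rewrite -[LHS]addr0 -H0 /H addrCA subrr addr0.
have /orthomx_spectralP := Hn; rewrite (invmx_unitary (spectral_unitarymx H)) => HE.
suff D0 : spectral_diag H = 0 by rewrite HE D0 linear0 mulmx0 mul0mx.
apply/rowP => i; rewrite -(quad_unitary_diag _ i (spectral_unitarymx H)) -HE.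
by rewrite Hq mxE.
Qed.

Lemma posdefmx_psd A : posdefmx A -> psdmx A.
Proof.
move=> Apos v; have [->|/Apos/ltW//] := eqVneq v 0.
by rewrite mulmx0 mxE.
Qed.

Lemma unitary_delta_neq0 U i : U \is unitarymx ->
  U^t* *m delta_mx i (0 : 'I_1) != 0.
Proof.
move=> Uu; apply/eqP => /(congr1 (mulmx U)).
rewrite mulmxA (unitary_mul_adj Uu) mul1mx mulmx0.
move=> /(congr1 (fun M : 'cV[R[i]]_n => M i 0)).
by rewrite !mxE !eqxx => /eqP; rewrite oner_eq0.
Qed.

Lemma psdmx_unidiag_ge0 U d i : U \is unitarymx -> psdmx (unidiag U d) -> 0 <= d i.
Proof. by move=> Uu /(_ (U^t* *m delta_mx i 0)); rewrite quad_unidiag// ler0c. Qed.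

Lemma posdefmx_unidiag_gt0 U d i : U \is unitarymx ->
  posdefmx (unidiag U d) -> 0 < d i.
Proof.
move=> Uu /(_ _ (unitary_delta_neq0 i Uu)); rewrite quad_unidiag//.
by rewrite ltcR.
Qed.

Lemma posdefmx_congruence A (S : 'M[R[i]]_n) : S \in unitmx -> posdefmx A ->
  posdefmx (S^t* *m A *m S).
Proof.
move=> Su Apos v v0; have := Apos (S *m v); rewrite adjmxM !mulmxA; apply.
by apply: contraNneq v0 => /(congr1 (mulmx (invmx S))); rewrite mulKmx// mulmx0 => ->.
Qed.

Lemma psdmx_gram m (S : 'M[R[i]]_(m, n)) : psdmx (S^t* *m S).
Proof.
move=> v; rewrite -mulmxA -mulmxA mulmxA -adjmxM mxE sumr_ge0// => i _.
by rewrite !mxE mulrC mul_conjC_ge0.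
Qed.

(** The doubly stochastic matrix of transition probabilities between two
    orthonormal bases. *)
Definition overlap U V (a b : 'I_n) : R := complex.Re (`|(V *m U^t*) a b| ^+ 2).

Lemma overlapE U V a b : (overlap U V a b)%:C = `|(V *m U^t*) a b| ^+ 2.
Proof. by rewrite RRe_real// ger0_real// exprn_ge0. Qed.

Lemma overlap_ge0 U V a b : 0 <= overlap U V a b.
Proof. by rewrite -ler0c overlapE exprn_ge0. Qed.

Lemma overlap_sumr U V a : U \is unitarymx -> V \is unitarymx ->
  \sum_b overlap U V a b = 1.
Proof.
move=> Uu Vu; apply: (@complexI R); rewrite rmorph_sum rmorph1.
have : ((V *m U^t*) *m (V *m U^t*)^t*) a a = 1.
  rewrite adjmxM trmxCK mulmxA -[_ *m U^t* *m U]mulmxA (unitary_adj_mul Uu).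
  by rewrite mulmx1 (unitary_mul_adj Vu) mxE eqxx.
rewrite mxE => <-; apply: eq_bigr => b _.
by rewrite -[LHS]/((overlap U V a b)%:C) overlapE normCK !mxE.
Qed.

Lemma overlapC U V a b : overlap U V a b = overlap V U b a.
Proof.
apply: (@complexI R); rewrite !overlapE.
have -> : V *m U^t* = (U *m V^t*)^t* by rewrite adjmxM trmxCK.
by rewrite 2!mxE norm_conjC.
Qed.

Lemma mxtrace_unidiag_mul U V d e :
  \tr (unidiag V d *m unidiag U e) =
  (\sum_a \sum_b overlap U V a b * (d a * e b))%:C.
Proof.
pose W := V *m U^t*.
have -> : \tr (unidiag V d *m unidiag U e) =
    \tr (diagR d *m W *m (diagR e *m W^t*)).
  have -> : W^t* = U *m V^t* by rewrite /W adjmxM trmxCK.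
  exact: mxtrace_rotate6.
have HW a b : (overlap U V a b)%:C = W a b * Num.conj (W a b).
  by rewrite overlapE normCK.
move: W HW => W HW; rewrite /mxtrace rmorph_sum; apply: eq_bigr => a _.
rewrite mul_diag_mx mul_diag_mx mxE rmorph_sum; apply: eq_bigr => b _.
rewrite !mxE -[RHS]/((overlap U V a b * (d a * e b))%:C).
by rewrite !rmorphM/= HW; ring.
Qed.

End FunctionalCalculus.

(** * The generator of a quantum Markov semigroup *)

Section CompletePositivity.
Context {R : realType} {n : nat}.
Implicit Types (Phi : 'M[R[i]]_n -> 'M[R[i]]_n).

(** The block matrix with blocks [u_i u_j^*] is a Gram matrix. *)
Lemma completely_positive_form Phi k (u w : 'I_k -> 'cV[R[i]]_n) :
  completely_positive Phi ->
  0 <= (\sum_i \sum_j (w i)^t* *m Phi (u i *m (u j)^t*) *m w j) 0 0.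
Proof.
move=> cp; have := cp k (fun i j => u i *m (u j)^t*).
have -> : \mxblock_(i < k, j < k) (u i *m (u j)^t*) =
    ((\mxcol_i u i)^t*)^t* *m (\mxcol_i u i)^t*.
  rewrite trmxCK -(mul_mxcol_mxrow u (fun j => (u j)^t*)); congr (_ *m _).
  by apply/matrixP => i j; rewrite !mxE.
move=> /(_ (psdmx_gram _)) /(_ (\mxcol_i w i)).
have -> : (\mxcol_i w i)^t* = \mxrow_i ((w i)^t*).
  by apply/matrixP => i j; rewrite !mxE.
rewrite -mulmxA mul_mxblock_mxrow mul_mxrow_mxcol.
under eq_bigr do rewrite mulmx_sumr.
by under eq_bigr do under eq_bigr do rewrite mulmxA.
Qed.

Lemma completely_positive_form_fin Phi (I : finType) (u w : I -> 'cV[R[i]]_n) :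
  completely_positive Phi ->
  0 <= (\sum_i \sum_j (w i)^t* *m Phi (u i *m (u j)^t*) *m w j) 0 0.
Proof.
move=> cp; have bij := onW_bij xpredT (enum_val_bij I).
rewrite (reindex _ bij); under eq_bigr do rewrite (reindex _ bij).
exact: (completely_positive_form (u \o enum_val) (w \o enum_val)).
Qed.

(** The Gram block matrix of [1] and [X] is positive semidefinite, and its
    image is Hermitian. *)
Lemma completely_positive_adj Phi X :
  completely_positive Phi -> Phi (X^t*) = (Phi X)^t*.
Proof.
move=> cp; pose B (i : 'I_2) : 'M[R[i]]_n := if i == 0 then 1%:M else X.
have := cp 2 (fun i j => (B i)^t* *m B j).
have -> : \mxblock_(i < 2, j < 2) ((B i)^t* *m B j) =
    (\mxrow_i B i)^t* *m (\mxrow_i B i).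
  rewrite -(mul_mxcol_mxrow (fun i => (B i)^t*) B); congr (_ *m _).
  by apply/matrixP => i j; rewrite !mxE.
move=> /(_ (psdmx_gram _)) /psdmx_adj.
move=> /(congr1 (fun M => submxblock M 1 0)); rewrite [RHS]mxblockK.
rewrite /B /= mulmx1 => <-.
apply/matrixP => i j; rewrite !mxE.
have := congr1 (fun M : 'M[R[i]]_n => M j i)
  (mxblockK (fun i j : 'I_2 => Phi ((B i)^t* *m B j)) 0 1).
by rewrite !mxE /B/= adjmx1 mul1mx => ->.
Qed.

End CompletePositivity.

Section Generator.
Context {R : realType} {n : nat}.
Variables (P : R -> 'M[R[i]]_n -> 'M[R[i]]_n) (L : 'M[R[i]]_n -> 'M[R[i]]_n).
Hypotheses (hP : is_qms P) (hL : is_generator P L).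
Local Notation C := (R[i] : numClosedFieldType).

Definition quotient_entry (X : 'M[R[i]]_n) i j (t : R) : C :=
  (t^-1)%:C * (P t X i j - X i j).

Lemma generator_entry X i j :
  (quotient_entry X i j t @[t --> 0^'+] --> (L X i j : C))%classic.
Proof.
have := @cvg_comp _ _ _ _ (fun M : 'M[C]_n => M i j : C) _ _ _ (@hL X)
  (@coord_continuous C n n i j (L X)).
apply: cvg_trans; apply: near_eq_cvg; near=> t.
by rewrite /quotient_entry /= !mxE.
Unshelve. all: by end_near. Qed.

Arguments generator_entry : clear implicits.

Lemma cvg_right_unique (f g : R -> C) (a b : C) :
  (f t @[t --> 0^'+] --> a)%classic -> (g t @[t --> 0^'+] --> b)%classic ->
  (forall t, 0 < t -> f t = g t) -> a = b.
Proof.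
move=> fa gb fg; apply: (cvg_unique (@norm_hausdorff _ _) _ gb).
apply: cvg_trans fa; apply: near_eq_cvg; by near=> t; rewrite fg.
Unshelve. all: by end_near. Qed.

(** In the partial order of the complex numbers, nonnegativity is the closed
    condition [a = |a|]. *)
Lemma cvg_right_ge0 (f : R -> C) (a : C) :
  (f t @[t --> 0^'+] --> a)%classic -> (forall t, 0 < t -> 0 <= f t) -> 0 <= a.
Proof.
move=> fa f0; suff -> : a = `|a| by [].
by apply: (cvg_right_unique fa (cvg_norm fa)) => t /f0/ger0_norm ->.
Qed.

Lemma cvg_right_sum (I : finType) (f : I -> R -> C) (g : I -> C) :
  (forall i, (f i t @[t --> 0^'+] --> g i)%classic) ->
  (\sum_i f i t @[t --> 0^'+] --> \sum_i g i)%classic.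
Proof. by move=> fg; apply: cvg_big => // x; exact: add_continuous. Qed.

Lemma generator_linear : linear L.
Proof.
move=> a X Y; apply/matrixP => i j; rewrite !mxE.
have limD : ((a : C) * quotient_entry X i j t + quotient_entry Y i j t
    @[t --> 0^'+] --> (a * L X i j + L Y i j : C))%classic.
  apply: cvgD; last exact: generator_entry.
  by apply: cvgMl_tmp; exact: generator_entry.
apply: (cvg_right_unique (generator_entry (a *: X + Y) i j) limD) => t t0.
by rewrite /quotient_entry (qms_linear hP (ltW t0)) !mxE; ring.
Qed.

Lemma generator1 : L 1%:M = 0.
Proof.
apply/matrixP => i j; rewrite [RHS]mxE.
apply: (cvg_right_unique (generator_entry 1%:M i j) (cvg_cst (0 : C))) => t t0.
by rewrite /quotient_entry (qms_unital hP (ltW t0)) subrr mulr0.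
Qed.

Lemma generator_adj X : L (X^t*) = (L X)^t*.
Proof.
apply/matrixP => i j; rewrite [RHS]mxE [in RHS]mxE.
have conj_cont (f : R -> C) (a : C) : (f t @[t --> 0^'+] --> a)%classic ->
    ((Num.conj (f t) : C) @[t --> 0^'+] --> (Num.conj a : C))%classic.
  move=> /cvgrPdist_lt fa; apply/cvgrPdist_lt => e /fa.
  by apply: filterS => t; rewrite -rmorphB norm_conjC.
apply: (cvg_right_unique (generator_entry (X^t*) i j)
  (conj_cont _ _ (generator_entry X j i))) => t t0.
rewrite /quotient_entry (completely_positive_adj _ (qms_cp hP (ltW t0))) !mxE.
rewrite rmorphM rmorphB; congr (_ * _).
exact/esym/conj_real_complex.
Qed.

(** The second-order contribution [(w_i^* u_i)(u_j^* w_j)] of the identity map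
    drops out of the difference quotient, which is then the form of the
    completely positive map [P t] divided by [t]. *)
Lemma generator_conditionally_cp (I : finType) (u w : I -> 'cV[R[i]]_n) :
  \sum_i (w i)^t* *m u i = 0 ->
  0 <= (\sum_i \sum_j (w i)^t* *m L (u i *m (u j)^t*) *m w j) 0 0.
Proof.
move=> wu0.
have form_entry (M : 'M[R[i]]_n) (x y : 'cV[R[i]]_n) :
    (x^t* *m M *m y) 0 0 = \sum_b \sum_a Num.conj (x a 0) * y b 0 * M a b.
  rewrite mxE; apply: eq_bigr => b _; rewrite mxE mulr_suml.
  by apply: eq_bigr => a _; rewrite !mxE; ring.
have sum_entry (F : I -> I -> 'M[R[i]]_1) :
    (\sum_i \sum_j F i j) 0 0 = \sum_i \sum_j F i j 0 0.
  by rewrite summxE; apply: eq_bigr => i _; rewrite summxE.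
rewrite sum_entry; under eq_bigr do under eq_bigr do rewrite form_entry.
pose z t := \sum_i \sum_j \sum_b \sum_a
  Num.conj (w i a 0) * w j b 0 * quotient_entry (u i *m (u j)^t*) a b t : C.
apply: (@cvg_right_ge0 z).
  rewrite /z; apply: cvg_right_sum => i; apply: cvg_right_sum => j.
  apply: cvg_right_sum => b; apply: cvg_right_sum => a.
  by apply: cvgMl_tmp; exact: generator_entry.
move=> t t0.
have -> : z t = (t^-1)%:C *
    (\sum_i \sum_j (w i)^t* *m P t (u i *m (u j)^t*) *m w j) 0 0.
  have -> : \sum_i \sum_j (w i)^t* *m P t (u i *m (u j)^t*) *m w j =
      \sum_i \sum_j (w i)^t* *m (P t (u i *m (u j)^t*) - u i *m (u j)^t*) *m w j.
    under [RHS]eq_bigr do under eq_bigr do rewrite mulmxBr mulmxBl.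
    under [RHS]eq_bigr do rewrite sumrB.
    rewrite sumrB [X in _ - X](_ : _ = 0) ?subr0//.
    transitivity ((\sum_i (w i)^t* *m u i) *m (\sum_j (u j)^t* *m w j)).
      by rewrite mulmx_suml; apply: eq_bigr => i _; rewrite mulmx_sumr;
        apply: eq_bigr => j _; rewrite !mulmxA.
    by rewrite wu0 mul0mx.
  rewrite sum_entry mulr_sumr; apply: eq_bigr => i _.
  rewrite mulr_sumr; apply: eq_bigr => j _; rewrite form_entry mulr_sumr.
  apply: eq_bigr => b _; rewrite mulr_sumr; apply: eq_bigr => a _.
  by rewrite /quotient_entry !mxE; ring.
rewrite mulr_ge0 ?ler0c ?invr_ge0 ?(ltW t0)//.
exact: completely_positive_form_fin (qms_cp hP (ltW t0)).
Qed.

End Generator.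

(** * Stroock-Varopoulos inequality *)

Section LevyForm.
Context {R : realType} {n : nat}.
Local Notation M := 'M[R[i]]_n.
Variables (V U : M) (s z : 'I_n -> R) (L : {linear M -> M}).
Hypotheses (Vu : V \is unitarymx) (Uu : U \is unitarymx).
Hypotheses (s0 : forall a, 0 < s a) (z0 : forall k, 0 < z k).
Hypothesis L_adj : forall X, L (X^t*) = (L X)^t*.
Hypothesis L1 : L 1%:M = 0.
Hypothesis L_ccp : forall (I : finType) (u w : I -> 'cV[R[i]]_n),
  \sum_i (w i)^t* *m u i = 0 ->
  0 <= (\sum_i \sum_j (w i)^t* *m L (u i *m (u j)^t*) *m w j) 0 0.
Hypothesis L_gns : gns_detailed_balance (unidiag V s) L.

Definition eigvec (B : M) k : 'cV[R[i]]_n := col k (B^t*).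

Lemma adj_eigvec (B : M) k : (eigvec B k)^t* = row k B.
Proof. by apply/matrixP => i j; rewrite !mxE conjCK. Qed.

Lemma unidiag_sum (B : M) d :
  unidiag B d = \sum_k (d k)%:C *: (eigvec B k *m (eigvec B k)^t*).
Proof.
apply/matrixP => i j; rewrite summxE mxE; apply: eq_bigr => k _.
rewrite adj_eigvec mul_mx_diag !mxE big_ord1 !mxE; ring.
Qed.

Lemma eigvec_dot (A B : M) a k :
  (eigvec A a)^t* *m eigvec B k = ((A *m B^t*) a k)%:M.
Proof.
apply/matrixP => i j; rewrite !ord1 adj_eigvec !mxE eqxx mulr1n.
by apply: eq_bigr => l _; rewrite !mxE.
Qed.

Lemma unidiag_eigvec g a :
  unidiag V g *m eigvec V a = (g a)%:C *: eigvec V a.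
Proof.
rewrite unidiag_sum mulmx_suml (bigD1 a)//= big1 ?addr0.
  rewrite -scalemxAl -mulmxA eigvec_dot (unitary_mul_adj Vu).
  by rewrite mul_mx_scalar mxE eqxx scale1r.
move=> b ba; rewrite -scalemxAl -mulmxA eigvec_dot (unitary_mul_adj Vu).
by rewrite mul_mx_scalar mxE (negbTE ba) scale0r scaler0.
Qed.

Let W := V *m U^t*.

Lemma unidiag_eigvec_expand g k : unidiag V g *m eigvec U k =
  \sum_c (g c)%:C *: (W c k *: eigvec V c).
Proof.
rewrite unidiag_sum mulmx_suml; apply: eq_bigr => c _.
by rewrite -scalemxAl -mulmxA eigvec_dot mul_mx_scalar.
Qed.

Definition eigen_unit a b : M := eigvec V a *m (eigvec V b)^t*.

Let K a b c d : R[i] := \tr (eigen_unit d c *m L (eigen_unit a b)).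

Lemma gns_trace A B :
  \tr (unidiag V s *m L A *m B) = \tr (unidiag V s *m A *m L B).
Proof. by have := L_gns (A^t*) B; rewrite /gns_inner -L_adj trmxCK. Qed.

Lemma unidiag_eigen_unit a b :
  unidiag V s *m eigen_unit a b = (s a)%:C *: eigen_unit a b.
Proof. by rewrite mulmxA unidiag_eigvec scalemxAl. Qed.

Lemma eigen_unit_unidiag a b :
  eigen_unit a b *m unidiag V s = (s b)%:C *: eigen_unit a b.
Proof.
rewrite /eigen_unit -mulmxA -[unidiag V s]unidiag_adj -adjmxM unidiag_eigvec.
by rewrite adjmxZ conj_real_complex -scalemxAr.
Qed.

(** Detailed balance, after absorbing an eigenvalue of [sigma] into the matrix
    unit on its left; [K_swap_right] does the same on its right. The two agree
    only if [L] preserves the Bohr frequency. *)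
Let K_swap_left a b c d : (s d)%:C * K a b c d = (s b)%:C * K d c b a.
Proof.
rewrite /K -mxtraceZ scalemxAl -unidiag_eigen_unit -gns_trace.
rewrite -mulmxA mxtrace_mulC -mulmxA eigen_unit_unidiag -scalemxAr mxtraceZ.
by rewrite mxtrace_mulC.
Qed.

Let K_swap_right a b c d : (s c)%:C * K a b c d = (s a)%:C * K d c b a.
Proof.
rewrite /K -mxtraceZ scalemxAl -eigen_unit_unidiag -mulmxA mxtrace_mulC.
rewrite gns_trace unidiag_eigen_unit -scalemxAl mxtraceZ.
by [].
Qed.

Lemma generator_form_expand (p q : 'I_n -> R[i]) (e := eigvec V) :
  let x := \sum_c p c *: e c in let y := \sum_a q a *: e a in
  (x^t* *m L (y *m y^t*) *m x) 0 0 = \sum_a \sum_c \sum_b \sum_d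
    Num.conj (p c) * q a * Num.conj (q b) * p d * K a b c d.
Proof.
move=> x y; have -> : L (y *m y^t*) =
    \sum_a \sum_b (q a * Num.conj (q b)) *: L (eigen_unit a b).
  rewrite {1}/y mulmx_suml linear_sum; apply: eq_bigr => a _.
  rewrite /y adjmx_sum mulmx_sumr linear_sum; apply: eq_bigr => b _.
  by rewrite adjmxZ -scalemxAr -scalemxAl scalerA linearZ mulrC.
have xNx (N : M) : (x^t* *m N *m x) 0 0 =
    \sum_c \sum_d Num.conj (p c) * p d * \tr (eigen_unit d c *m N).
  rewrite mx11_trace /x adjmx_sum !mulmx_suml mxtrace_sum.
  apply: eq_bigr => c _; rewrite mulmx_sumr mxtrace_sum; apply: eq_bigr => d _.
  rewrite adjmxZ -!scalemxAl -scalemxAr !mxtraceZ mulrA; congr (_ * _).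
  by rewrite mxtrace_mulC mulmxA.
rewrite xNx.
under eq_bigr do under eq_bigr do rewrite mulmx_sumr mxtrace_sum mulr_sumr.
under eq_bigr do rewrite exchange_big.
rewrite exchange_big; apply: eq_bigr => a _.
apply: eq_bigr => c _.
under eq_bigr do rewrite mulmx_sumr mxtrace_sum mulr_sumr.
rewrite exchange_big; apply: eq_bigr => b _; apply: eq_bigr => d _.
by rewrite -scalemxAr mxtraceZ /K; ring.
Qed.

(** The form of [L] between the components of the [l]-th eigenvector of [U] as
    input and of the [k]-th as output; an index pairs an input and an output
    eigenvector of [sigma]. *)
Let T k l (i j : 'I_n * 'I_n) : R[i] :=
  Num.conj (W i.2 k) * W i.1 l * Num.conj (W j.1 l) * W j.2 k *
  K i.1 j.1 i.2 j.2.

Let ratio (i : 'I_n * 'I_n) : R := s i.2 / s i.1.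

Let ratio_gt0 i : 0 < ratio i. Proof. exact: divr_gt0. Qed.

Let s_neq0 a : s a != 0. Proof. by rewrite gt_eqF. Qed.

(** [L] commutes with the modular group of [sigma]. *)
Let T_vanish k l i j : ratio i != ratio j -> T k l i j = 0.
Proof.
case: i j => [a c] [b d] ne; rewrite /T/=.
suff -> : K a b c d = 0 by rewrite mulr0.
have : ((s a * s d - s b * s c)%:C) * K a b c d = 0.
  rewrite rmorphB mulrBl !rmorphM -!mulrA K_swap_left.
  rewrite (K_swap_right a b c d).
  by rewrite mulrCA subrr.
move/eqP; rewrite mulf_eq0 fmorph_eq0 subr_eq0 => /orP[/eqP E|/eqP//].
case/eqP: ne; apply/eqP.
by rewrite /ratio/= eqr_div// mulrC -E mulrC.
Qed.

(** Reversibility: exchanging input and output inverts the frequency. *)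
Let T_swap k l i j :
  (ratio i)%:C * T k l i j = T l k (j.2, j.1) (i.2, i.1).
Proof.
case: i j => [a c] [b d]; rewrite /T /ratio/= rmorphM/= fmorphV.
have sa : (s a)%:C != 0 by rewrite fmorph_eq0 gt_eqF.
have -> : K d c b a = (s c)%:C / (s a)%:C * K a b c d.
  by apply: (mulfI sa); rewrite -K_swap_right; field.
ring.
Qed.

(** The form attached to a jump of frequency [r], compressed to the pairs of
    eigenvectors of [sigma] with ratio [r]. *)
Let jump k l r : R[i] :=
  \sum_i \sum_j ((ratio i == r) && (ratio j == r))%:R * T k l i j.

(** Conditional complete positivity applies because the sum of the [w_i^* u_i]
    reduces to [1] if [k = l] and [r = 1], and to [0] otherwise. *)
Let jump_ge0 k l r : (k != l) || (r != 1) -> 0 <= jump k l r.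
Proof.
move=> klr; pose u (i : 'I_n * 'I_n) := W i.1 l *: eigvec V i.1.
pose w (i : 'I_n * 'I_n) := (ratio i == r)%:R *: (W i.2 k *: eigvec V i.2).
have -> : jump k l r = (\sum_i \sum_j (w i)^t* *m L (u i *m (u j)^t*) *m w j) 0 0.
  rewrite summxE; apply: eq_bigr => i _; rewrite summxE; apply: eq_bigr => j _.
  have -> : u i *m (u j)^t* =
      (W i.1 l * Num.conj (W j.1 l)) *: eigen_unit i.1 j.1.
    by rewrite adjmxZ -scalemxAr -scalemxAl scalerA mulrC.
  rewrite [L _]linearZ mx11_trace /w !scalerA mxtrace_form_scale -/(eigen_unit _ _).
  by rewrite rmorphM/= conjC_nat -mulnb natrM /T /K; ring.
apply: L_ccp.
have -> : \sum_i (w i)^t* *m u i =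
  \sum_a ((1 == r)%:R * Num.conj (W a k) * W a l)%:M.
  transitivity (\sum_a \sum_c (w (a, c))^t* *m u (a, c)).
    by rewrite pair_bigA; apply: eq_bigr => -[].
  apply: eq_bigr => a _; rewrite (bigD1 a)//= big1 ?addr0.
    rewrite /w /u !adjmxZ conjC_nat -!scalemxAl -scalemxAr eigvec_dot.
    rewrite (unitary_mul_adj Vu) [1%:M _ _]mxE eqxx /ratio/= divff//.
    by rewrite !scale_scalar_mx mulr1 mulrA.
  move=> c ca; rewrite /w /u !adjmxZ conjC_nat -!scalemxAl -scalemxAr eigvec_dot.
  by rewrite (unitary_mul_adj Vu) [1%:M _ _]mxE (negbTE ca)/= raddf0 !scaler0.
rewrite -[LHS](raddf_sum (@scalar_mx _ 1)).
suff -> : \sum_a (1 == r)%:R * Num.conj (W a k) * W a l = 0 by rewrite raddf0.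
under eq_bigr do rewrite -mulrA; rewrite -mulr_sumr.
have -> : \sum_a Num.conj (W a k) * W a l = (k == l)%:R.
  have : (W^t* *m W) k l = (k == l)%:R.
    rewrite /W adjmxM trmxCK mulmxA -[_ *m V^t* *m V]mulmxA.
    by rewrite (unitary_adj_mul Vu) mulmx1 (unitary_mul_adj Uu) mxE.
  by rewrite mxE => <-; apply: eq_bigr => a _; rewrite !mxE.
case/orP: klr => [/negbTE->|]; first by rewrite mulr0.
by rewrite eq_sym => /negbTE->; rewrite mul0r.
Qed.


(** The image of the [k]-th eigenvector of [U] under the diagonal operator
    [unidiag V g], expanded in the eigenbasis of [sigma]. *)
Let smeared g k := \sum_c ((g c)%:C * W c k) *: eigvec V c.

Let smearedE g k : smeared g k = unidiag V g *m eigvec U k.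
Proof.
by rewrite unidiag_eigvec_expand; apply: eq_bigr => c _; rewrite scalerA.
Qed.

Let mxtrace_rank_one_sum d g (N : M) :
  \tr (unidiag U d *m unidiag V g *m N *m unidiag V g) =
  \sum_k (d k)%:C * ((smeared g k)^t* *m N *m smeared g k) 0 0.
Proof.
rewrite (unidiag_sum U) !mulmx_suml mxtrace_sum; apply: eq_bigr => k _.
rewrite mx11_trace -!scalemxAl mxtraceZ; congr (_ * _).
rewrite smearedE adjmxM unidiag_adj; move: (unidiag V g) (eigvec U k) => S x.
by rewrite -!mulmxA mxtrace_mulC !mulmxA.
Qed.

Let sandwich_rank_one_sum d h :
  unidiag V h *m unidiag U d *m unidiag V h =
  \sum_l (d l)%:C *: (smeared h l *m (smeared h l)^t*).
Proof.
rewrite (unidiag_sum U) mulmx_sumr mulmx_suml; apply: eq_bigr => l _.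
rewrite -scalemxAr -scalemxAl smearedE adjmxM unidiag_adj.
by move: (unidiag V h) (eigvec U l) => S x; rewrite !mulmxA.
Qed.

Let quadratic_sum (x : 'cV[R[i]]_n) (d : 'I_n -> R) (N : 'I_n -> M) :
  (x^t* *m L (\sum_l (d l)%:C *: N l) *m x) 0 0 =
  \sum_l (d l)%:C * (x^t* *m L (N l) *m x) 0 0.
Proof.
rewrite linear_sum mulmx_sumr mulmx_suml summxE; apply: eq_bigr => l _.
by rewrite linearZ/= -scalemxAr -scalemxAl mxE.
Qed.

(** With [tau = unidiag U z] and [sigma = unidiag V s] this is
    [tr (tau^(1-t) Gamma^t (L (Gamma^(-t) (tau^t))))]. *)
Definition sv_form (t : R) : R[i] :=
  \tr (unidiag U (fun k => z k `^ (1 - t)) *m unidiag V (fun a => s a `^ (t / 2))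
    *m L (unidiag V (fun a => s a `^ (- (t / 2))) *m unidiag U (fun k => z k `^ t)
          *m unidiag V (fun a => s a `^ (- (t / 2))))
    *m unidiag V (fun a => s a `^ (t / 2))).

Let sv_form_expand t : sv_form t =
  \sum_k \sum_l (z k `^ (1 - t) * z l `^ t)%:C *
    \sum_i \sum_j (ratio i `^ t)%:C * T k l i j.
Proof.
pose g a := s a `^ (t / 2); pose h a := s a `^ (- (t / 2)).
have gh i : g i.2 * h i.1 = ratio i `^ (t / 2).
  rewrite /g /h /ratio powRN powRM ?invr_ge0 ?ltW//; congr (_ * _).
  by rewrite -[(s i.1)^-1]powR_inv1 ?ltW// -powRrM mulN1r powRN.
rewrite /sv_form -/g -/h mxtrace_rank_one_sum sandwich_rank_one_sum.
apply: eq_bigr => k _.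
rewrite quadratic_sum mulr_sumr; apply: eq_bigr => l _.
rewrite mulrA rmorphM; congr (_ * _).
rewrite /smeared generator_form_expand.
under [RHS]eq_bigr do rewrite -(pair_bigA _ (fun b d => _ * T k l _ (b, d)))/=.
rewrite -(pair_bigA _ (fun a c => \sum_b \sum_d
  (ratio (a, c) `^ t)%:C * T k l (a, c) (b, d)))/=.
apply: eq_bigr => a _; apply: eq_bigr => c _; apply: eq_bigr => b _.
apply: eq_bigr => d _.
transitivity ((g c * h a * (g d * h b))%:C * T k l (a, c) (b, d)).
  by rewrite /T !rmorphM/= !conj_real_complex; ring.
have [E|/T_vanish->] := eqVneq (ratio (a, c)) (ratio (b, d)); last by rewrite !mulr0.
have := gh (a, c); have := gh (b, d); rewrite -E /= => -> ->.
by rewrite -powRD ?(gt_eqF (ratio_gt0 _)) ?implybT// -splitr.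
Qed.


(** The form at [1 - t] is the form at [t] with input and output exchanged; the
    change of variables exchanges [k] with [l] and reverses the two pairs. *)
Let sv_form_flip t : sv_form (1 - t) = sv_form t.
Proof.
rewrite !sv_form_expand exchange_big/=; apply: eq_bigr => k _.
apply: eq_bigr => l _; rewrite subKr; congr (_ * _); first by rewrite mulrC.
pose flip (x : ('I_n * 'I_n) * ('I_n * 'I_n)) :=
  ((x.2.2, x.2.1), (x.1.2, x.1.1)).
have flipK : cancel flip flip by move=> [[a c] [b d]].
rewrite (pair_bigA _ (fun i j => (ratio i `^ (1 - t))%:C * T l k i j)).
rewrite (pair_bigA _ (fun i j => (ratio i `^ t)%:C * T k l i j)) /=.
rewrite (reindex_inj (can_inj flipK)); apply: eq_bigr => -[i j] _ /=.
rewrite -T_swap mulrA -rmorphM.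
have [E|/T_vanish->] := eqVneq (ratio i) (ratio j); last by rewrite !mulr0.
congr (_%:C * _); case: i j E => [a c] [b d] /= E.
have -> : ratio (d, b) = (ratio (a, c))^-1 by rewrite E /ratio/= invf_div.
move: (ratio_gt0 (a, c)); move: (ratio _) => r r0.
rewrite -[r^-1]powR_inv1 ?ltW// -powRrM -[X in _ * X]powRr1 ?ltW//.
by rewrite -powRD ?(gt_eqF r0) ?implybT//; congr (_ `^ _); ring.
Qed.

Let sv_form0 : sv_form 0 = 0.
Proof.
have one (B : M) (f : 'I_n -> R) : B \is unitarymx ->
    unidiag B (fun k => f k `^ 0) = 1%:M.
  by move=> Bu; rewrite -(unidiag1 Bu); apply: eq_unidiag => k; rewrite powRr0.
rewrite /sv_form mul0r oppr0 (one U z Uu) (one V s Vu).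
by rewrite !mulmx1 L1 mulmx0 mxtrace0.
Qed.

(** Spectral decomposition of the form over the frequencies
    [s_c z_l / (s_a z_k)]. Conditional complete positivity makes all the
    weights nonnegative except those at the frequency [1]. *)
Lemma sv_form_levy : exists (J : finType) (c x : J -> R),
  [/\ forall j, 0 < x j, forall j, x j != 1 -> 0 <= c j &
      forall t, complex.Re (sv_form t) = \sum_j c j * x j `^ t].
Proof.
(* Summing over all [m] meets each class of equal ratios as many times as it has
   elements, hence the division by the size [N m] of the class. *)
pose N m : R := \sum_i (ratio i == ratio m)%:R.
have N_gt0 m : 0 < N m.
  by rewrite /N (bigD1 m)//= eqxx ltr_pwDl ?ltr01// sumr_ge0.
pose J := ('I_n * 'I_n * ('I_n * 'I_n))%type.
pose x (j : J) := ratio j.2 * (z j.1.2 / z j.1.1).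
pose c (j : J) := z j.1.1 / N j.2 * complex.Re (jump j.1.1 j.1.2 (ratio j.2)).
exists J, c, x; split.
- by move=> j; rewrite mulr_gt0 ?divr_gt0.
- move=> [[k l] m]; rewrite /x /c /= => x1.
  apply: mulr_ge0; first by rewrite divr_ge0 ?ltW.
  suff : 0 <= jump k l (ratio m) by rewrite lecE => /andP[].
  apply: jump_ge0; rewrite -negb_and; apply: contra x1 => /andP[/eqP-> /eqP->].
  by rewrite divff ?mul1r// gt_eqF.
move=> t; rewrite sv_form_expand.
under eq_bigr => k _.
  under eq_bigr => l _.
    have -> : \sum_i \sum_j (ratio i `^ t)%:C * T k l i j =
        \sum_m (ratio m `^ t / N m)%:C * jump k l (ratio m).
      rewrite /jump; under [RHS]eq_bigr do rewrite mulr_sumr.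
      rewrite [RHS]exchange_big/=; apply: eq_bigr => i _.
      under [RHS]eq_bigr do rewrite mulr_sumr.
      rewrite [RHS]exchange_big/=; apply: eq_bigr => j _.
      have [E|/T_vanish->] := eqVneq (ratio i) (ratio j); last first.
        by rewrite mulr0 big1// => m _; rewrite !mulr0.
      under eq_bigr do rewrite -E andbb mulrA; rewrite -mulr_suml; congr (_ * _).
      transitivity (\sum_m (ratio i `^ t / N i * (ratio m == ratio i)%:R)%:C).
        by rewrite -rmorph_sum -mulr_sumr -/(N i) divfK// gt_eqF.
      apply: eq_bigr => m _; rewrite rmorphM rmorph_nat eq_sym.
      have [e|_] := eqVneq (ratio i) (ratio m); last by rewrite !mulr0.
      by rewrite !mulr1 /N e.
    over.
  over.
rewrite -(pair_bigA _ (fun kl m => c (kl, m) * x (kl, m) `^ t)).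
rewrite -(pair_bigA _ (fun k l => \sum_m c ((k, l), m) * x ((k, l), m) `^ t)).
rewrite Re_sum; apply: eq_bigr => k _; rewrite Re_sum; apply: eq_bigr => l _.
rewrite ReZ Re_sum mulr_sumr; apply: eq_bigr => m _; rewrite ReZ /c /x /=.
rewrite !powRM ?divr_ge0 ?invr_ge0 ?ltW//.
have -> : z k `^ (1 - t) = z k * (z k)^-1 `^ t.
  rewrite -[(z k)^-1]powR_inv1 ?ltW// -powRrM mulN1r.
  by rewrite powRD ?(gt_eqF (z0 k)) ?implybT// powRr1 ?ltW.
ring.
Qed.

(** The Stroock-Varopoulos inequality: the sum of [levy_comparison] over the
    representation of [sv_form], whose total mass and first moment are the values
    of the form at [0] and [1], hence zero. *)
Lemma stroock_varopoulos t : 1 / 2 <= t <= 1 ->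
  0 <= - complex.Re (sv_form (1 / 2)) /\
  4 * t * (1 - t) * - complex.Re (sv_form (1 / 2)) <= - complex.Re (sv_form t).
Proof.
move=> t01; have [J [c [x [x0 c0 FE]]]] := sv_form_levy.
have Re0 : complex.Re (0 : R[i]) = 0 by [].
have F0 : \sum_j c j = 0.
  rewrite -[RHS]Re0 -sv_form0 FE.
  by apply: eq_bigr => j _; rewrite powRr0 mulr1.
have F1 : \sum_j c j * x j = 0.
  rewrite -[RHS]Re0 -sv_form0 -[X in sv_form X](subrr 1) sv_form_flip FE.
  by apply: eq_bigr => j _; rewrite powRr1// ltW.
have Ft : \sum_j c j * x j `^ (1 - t) = \sum_j c j * x j `^ t.
  by rewrite -!FE sv_form_flip.
have := levy_comparison t01 x0 c0 F0 F1 Ft.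
rewrite -(FE (1 / 2)) -(FE t).
exact.
Qed.



End LevyForm.

(** * From the Poincare inequality to the Beckner inequality *)

Section WeightedNorms.
Context {R : realType} {n : nat}.
Local Notation M := 'M[R[i]]_n.
Implicit Types (A B X V U : M) (s y : 'I_n -> R) (p : R).

Lemma mxabs_unidiag U y : U \is unitarymx -> (forall k, 0 <= y k) ->
  mxabs (unidiag U y) = unidiag U y.
Proof.
move=> Uu y0; rewrite /mxabs unidiag_adj (unidiag_mul y y Uu).
rewrite (mxpow_unidiag _ _ Uu); apply: eq_unidiag => k.
by rewrite div1r powR12_sqrt ?mulr_ge0// -expr2 sqrtr_sqr ger0_norm.
Qed.

Lemma normp_powR U y A p X : U \is unitarymx -> (forall k, 0 <= y k) -> 0 < p ->
  Gamma A (1 / p) X = unidiag U y ->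
  normp A p X `^ p = \sum_k y k `^ p.
Proof.
move=> Uu y0 p0 E; rewrite /normp E (mxabs_unidiag Uu y0) (mxpow_unidiag _ _ Uu).
rewrite (mxtrace_unidiag _ Uu) -powRrM div1r mulVf ?gt_eqF// powRr1//.
by apply: sumr_ge0 => k _; exact: powR_ge0.
Qed.

Lemma normp2_sqr A X (B := Gamma A (1 / 2) X) :
  normp A 2 X ^+ 2 = complex.Re (\tr (B^t* *m B)).
Proof.
rewrite /normp -/B /mxabs; have Hpsd := psdmx_gram B.
have := hermitian_unidiag (psdmx_adj Hpsd); move: Hpsd.
move: (B^t* *m B) (spectral_unitarymx (B^t* *m B)) => H.
move: (spectralmx _) (fun i => _) => Q d Qu Hpsd HE; rewrite {}HE in Hpsd *.
have d0 k : 0 <= d k by exact: psdmx_unidiag_ge0 Hpsd.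
have -> : mxpow (mxpow (unidiag Q d) (1 / 2)) 2 = unidiag Q d.
  rewrite !(mxpow_unidiag _ _ Qu); apply: eq_unidiag => k.
  by rewrite -powRrM div1r mulVf ?pnatr_eq0// powRr1.
rewrite (mxtrace_unidiag _ Qu) /= div1r powR12_sqrt ?sumr_ge0// sqr_sqrtr//.
exact: sumr_ge0.
Qed.

Lemma Gamma_unidiag V s t X : V \is unitarymx -> Gamma (unidiag V s) t X =
  unidiag V (fun a => s a `^ (t / 2)) *m X *m unidiag V (fun a => s a `^ (t / 2)).
Proof. by move=> Vu; rewrite /Gamma (mxpow_unidiag _ _ Vu). Qed.

Lemma Gamma_adj V s t X : V \is unitarymx -> X^t* = X ->
  (Gamma (unidiag V s) t X)^t* = Gamma (unidiag V s) t X.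
Proof.
move=> Vu Xa; rewrite (Gamma_unidiag _ _ _ Vu).
have := unidiag_adj V (fun a => s a `^ (t / 2)).
by move: (unidiag V _) => S Sa; rewrite !adjmxM Sa Xa mulmxA.
Qed.

Lemma unidiag_powR_mul V s t u : V \is unitarymx -> (forall a, 0 < s a) ->
  unidiag V (fun a => s a `^ t) *m unidiag V (fun a => s a `^ u) =
  unidiag V (fun a => s a `^ (t + u)).
Proof.
move=> Vu s0; rewrite (unidiag_mul _ _ Vu); apply: eq_unidiag => a.
by rewrite powRD// (gt_eqF (s0 a)) implybT.
Qed.

Lemma unidiag_powR0 V s : V \is unitarymx ->
  unidiag V (fun a => s a `^ 0) = 1%:M.
Proof.
by move=> Vu; rewrite -(unidiag1 Vu); apply: eq_unidiag => a; rewrite powRr0.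
Qed.

Lemma GammaD V s t u X : V \is unitarymx -> (forall a, 0 < s a) ->
  Gamma (unidiag V s) t (Gamma (unidiag V s) u X) = Gamma (unidiag V s) (t + u) X.
Proof.
move=> Vu s0; rewrite 3!(Gamma_unidiag _ _ _ Vu).
have E1 := unidiag_powR_mul (t / 2) (u / 2) Vu s0.
have E2 := unidiag_powR_mul (u / 2) (t / 2) Vu s0.
rewrite mulrDl -{1}E1 addrC -E2.
by move: (unidiag V _) (unidiag V _) => S S'; rewrite !mulmxA.
Qed.

Lemma Gamma0 V s X : V \is unitarymx -> Gamma (unidiag V s) 0 X = X.
Proof.
by move=> Vu; rewrite (Gamma_unidiag _ _ _ Vu) mul0r (unidiag_powR0 _ Vu) mulmx1 mul1mx.
Qed.

Lemma GammaK V s t X : V \is unitarymx -> (forall a, 0 < s a) ->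
  Gamma (unidiag V s) (- t) (Gamma (unidiag V s) t X) = X.
Proof. by move=> Vu s0; rewrite (GammaD _ _ _ Vu s0) addNr (Gamma0 _ _ Vu). Qed.

Lemma posdefmx_Gamma V s t X : V \is unitarymx -> (forall a, 0 < s a) ->
  posdefmx X -> posdefmx (Gamma (unidiag V s) t X).
Proof.
move=> Vu s0 Xpos; rewrite (Gamma_unidiag _ _ _ Vu).
have := unidiag_powR_mul (t / 2) (- (t / 2)) Vu s0.
rewrite subrr (unidiag_powR0 _ Vu) => /mulmx1_unit[].
have := unidiag_adj V (fun a => s a `^ (t / 2)).
move: (unidiag V (fun a => s a `^ (t / 2))) => S Sadj Sunit _.
by rewrite -{1}Sadj; exact: posdefmx_congruence.
Qed.

Lemma posdefmx_unidiag X : posdefmx X ->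
  exists2 Uy : M * ('I_n -> R), Uy.1 \is unitarymx /\ (forall k, 0 < Uy.2 k) &
    X = unidiag Uy.1 Uy.2.
Proof.
move=> Xpos; have E := hermitian_unidiag (psdmx_adj (posdefmx_psd Xpos)).
have Uu := spectral_unitarymx X.
exists (spectralmx X, fun i => complex.Re (spectral_diag X 0 i)) => //; split=> //= k.
by move: Xpos; rewrite {1}E => /(posdefmx_unidiag_gt0 k Uu).
Qed.

End WeightedNorms.

(** With [D] the Dirichlet form, [E] the form at [t = 1 / p], [N - m ^+ 2] the
    variance and [N - Q] the Beckner functional, only inequalities between real
    numbers are left. A negative [lam] is dominated by [0 <= D]. *)
Lemma beckner_arithmetic {R : realType} (p c lam N m Q D E : R) :
  1 < p <= 2 -> 0 < c -> m ^+ 2 <= Q -> Q <= N ->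
  N - Q <= 2 * (p - 1) * c * (N - m ^+ 2) ->
  0 <= D -> 4 * (1 / p) * (1 - 1 / p) * D <= E -> lam * (N - m ^+ 2) <= D ->
  Num.max (1 / (2 * p * c)) ((p - 1) / p) * lam * hat p * (N - Q)
    <= hat p * p / 4 * E.
Proof.
move=> /andP[p1 p2] c0 mQ QN defect D0 DE lamD.
have p0 : 0 < p by lra.
have pp1 : 0 < p - 1 by lra.
have hat0 : 0 < hat p by rewrite divr_gt0.
set K := Num.max _ _.
have K0 : 0 <= K.
  by rewrite /K le_max; apply/orP; right; rewrite divr_ge0// ltW.
have DE' : D <= hat p * p / 4 * E.
  have -> : D = hat p * p / 4 * (4 * (1 / p) * (1 - 1 / p) * D).
    by rewrite /hat; field; rewrite !gt_eqF.
  by rewrite ler_wpM2l// !mulr_ge0 ?invr_ge0// ltW.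
apply: le_trans DE'.
have [lam0|lam0] := ltP lam 0.
  apply: le_trans D0; rewrite mulr_le0_ge0 ?subr_ge0//.
  by rewrite mulr_le0_ge0 ?(ltW hat0)// mulr_ge0_le0// ltW.
apply: le_trans lamD.
have -> : K * lam * hat p * (N - Q) = lam * (K * hat p * (N - Q)) by ring.
rewrite ler_wpM2l// /K; case: (leP (1 / (2 * p * c)) ((p - 1) / p)) => _.
  have -> : (p - 1) / p * hat p * (N - Q) = N - Q.
    by rewrite /hat; field; rewrite !gt_eqF.
  by rewrite lerD2l lerN2.
have -> : 1 / (2 * p * c) * hat p * (N - Q) = (N - Q) / (2 * (p - 1) * c).
  by rewrite /hat; field; rewrite !gt_eqF.
by rewrite ler_pdivrMr ?mulr_gt0// mulrC.
Qed.

Section BecknerFromPoincare.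
Context {R : realType} {n : nat}.
Local Notation M := 'M[R[i]]_n.
Variables (V : M) (s : 'I_n -> R) (L : {linear M -> M}) (p : R).
Hypotheses (Vu : V \is unitarymx) (s0 : forall a, 0 < s a).
Hypothesis s1 : \sum_a s a = 1.
Hypothesis L_adj : forall X, L (X^t*) = (L X)^t*.
Hypothesis L1 : L 1%:M = 0.
Hypothesis L_ccp : forall (I : finType) (u w : I -> 'cV[R[i]]_n),
  \sum_i (w i)^t* *m u i = 0 ->
  0 <= (\sum_i \sum_j (w i)^t* *m L (u i *m (u j)^t*) *m w j) 0 0.
Hypothesis L_gns : gns_detailed_balance (unidiag V s) L.
Hypothesis p12 : 1 < p <= 2.
Let sigma := unidiag V s.

Let p_gt0 : 0 < p. Proof. by case/andP: p12 => ? _; lra. Qed.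

Let index_inhabited : exists a : 'I_n, true.
Proof.
apply: contrapT => H; have := s1; rewrite big1 => [/eqP|a _].
  by rewrite eq_sym oner_eq0.
by case: H; exists a.
Qed.

Let lower_bound_le1 (smin : R) : (forall a, smin <= s a) -> smin <= 1.
Proof.
move=> smin_le; have [a0 _] := index_inhabited.
rewrite (le_trans (smin_le a0))// -s1 (bigD1 a0)//= lerDl.
by rewrite sumr_ge0// => k _; rewrite ltW.
Qed.

(** The classical pair of states with densities [s_a] and [z_b] with respect to
    the overlaps of the two eigenbases reproduces all the traces
    [tr (sigma^(1-t) tau^t)]. *)
Lemma two_state_comparison (smin : R) (U : M) (z : 'I_n -> R)
    (N := \sum_k z k)
    (q := \sum_a \sum_b overlap U V a b * (s a `^ (1 - 1 / p) * z b `^ (1 / p)))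
    (m := \sum_a \sum_b overlap U V a b * (s a `^ (1 / 2) * z b `^ (1 / 2))) :
  U \is unitarymx -> (forall k, 0 < z k) -> 0 < smin ->
  (forall a, smin <= s a) ->
  [/\ m ^+ 2 <= q `^ p, q `^ p <= N &
      N - q `^ p <= 2 * (p - 1) * (2 - ln smin) * (N - m ^+ 2)].
Proof.
move=> Uu z0 smin0 smin_le.
pose P (j : 'I_n * 'I_n) := s j.1 * overlap U V j.1 j.2.
pose h (j : 'I_n * 'I_n) := z j.2 / s j.1.
have pairE (F : 'I_n -> 'I_n -> R) : \sum_a \sum_b F a b = \sum_j F j.1 j.2.
  by rewrite pair_bigA.
have sumP t : \sum_j P j * h j `^ t =
    \sum_a \sum_b overlap U V a b * (s a `^ (1 - t) * z b `^ t).
  rewrite pairE; apply: eq_bigr => -[a b] _; rewrite /P /h /=.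
  have sV : (s a)^-1 = s a `^ (- 1) by rewrite powR_inv1 ?ltW.
  rewrite powRM ?invr_ge0 ?(ltW (z0 b)) ?(ltW (s0 a))// sV -powRrM mulN1r.
  rewrite powRD ?(gt_eqF (s0 a)) ?implybT// powRr1 ?(ltW (s0 a))//; ring.
have P0 j : 0 <= P j by rewrite mulr_ge0 ?overlap_ge0 ?ltW.
have P1 : \sum_j P j = 1.
  rewrite -s1 /P -(pairE (fun a b => s a * overlap U V a b)).
  by apply: eq_bigr => a _; rewrite -mulr_sumr overlap_sumr// mulr1.
have hN : \sum_j P j * h j = N.
  rewrite /P /h -(pairE (fun a b => s a * overlap U V a b * (z b / s a))).
  rewrite exchange_big; apply: eq_bigr => b _ /=.
  transitivity (\sum_a z b * overlap V U b a).
    apply: eq_bigr => a _; rewrite [overlap V U b a]overlapC.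
    by field; rewrite gt_eqF.
  by rewrite -mulr_sumr overlap_sumr// mulr1.
have h0 j : 0 < h j by rewrite divr_gt0.
have [a0 _] := index_inhabited.
have N0 : 0 < N.
  by rewrite /N (bigD1 a0)//= ltr_pwDl// sumr_ge0// => k _; rewrite ltW.
have hle j : h j <= smin^-1 * \sum_j P j * h j.
  rewrite hN mulrC ler_pM ?invr_ge0 ?(ltW (z0 _)) ?(ltW (s0 _))//.
    by rewrite /N (bigD1 j.2)//= lerDl sumr_ge0// => k _; rewrite ltW.
  by rewrite lef_pV2 ?posrE.
have smin1 : 1 <= smin^-1 by rewrite invf_ge1// (lower_bound_le1 smin_le).
have hN0 : 0 < \sum_j P j * h j by rewrite hN.
have := power_means P0 P1 p12 h0 hN0 hle smin1.
have -> : \sum_j P j * h j `^ p^-1 = q by rewrite sumP /q div1r.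
have -> : \sum_j P j * h j `^ (1 / 2) = m.
  rewrite sumP /m; suff -> : 1 - 1 / 2 = 1 / 2 :> R by [].
  by field.
by rewrite hN lnV ?posrE.
Qed.

Lemma beckner_energyE U y X : U \is unitarymx -> (forall k, 0 < y k) ->
  Gamma sigma (1 / p) X = unidiag U y ->
  beckner_energy sigma L p X = - (hat p * p / 4) *
    complex.Re (sv_form V U s (fun k => y k `^ p) L (1 / p)).
Proof.
move=> Uu y0 XE; rewrite /beckner_energy; congr (- _ * complex.Re _).
rewrite XE (mxpow_unidiag _ _ Uu).
have pow1 k : (y k `^ p) `^ (1 / p) = y k.
  by rewrite -powRrM mul1r divff ?gt_eqF// powRr1 ?ltW.
have powp k : (y k `^ p) `^ (1 - 1 / p) = y k `^ (p - 1).
  by rewrite -powRrM mulrBr mulr1 mul1r divff ?gt_eqF.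
have LX : unidiag V (fun a => s a `^ (- ((1 / p) / 2))) *m
    unidiag U (fun k => (y k `^ p) `^ (1 / p)) *m
    unidiag V (fun a => s a `^ (- ((1 / p) / 2))) = X.
  rewrite (eq_unidiag U pow1) -XE -mulNr -(Gamma_unidiag _ _ _ Vu).
  exact: (GammaK _ _ Vu s0).
rewrite /sv_form LX (eq_unidiag U powp) /kms_inner /sigma (mxpow_unidiag _ _ Vu).
rewrite (Gamma_adj _ _ Vu (unidiag_adj _ _)) (Gamma_unidiag _ _ _ Vu).
have E1 : unidiag V (fun a => s a `^ (1 / 2)) *m
    unidiag V (fun a => s a `^ (- (1 / hat p) / 2)) =
    unidiag V (fun a => s a `^ ((1 / p) / 2)).
  rewrite (unidiag_powR_mul _ _ Vu s0); apply: eq_unidiag => a; congr (_ `^ _).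
  have p1 : p - 1 != 0 by case/andP: p12 => ? _; rewrite gt_eqF// subr_gt0.
  by rewrite /hat; field; rewrite p1 gt_eqF.
have E2 : unidiag V (fun a => s a `^ (- (1 / hat p) / 2)) *m
    unidiag V (fun a => s a `^ (1 / 2)) =
    unidiag V (fun a => s a `^ ((1 / p) / 2)).
  rewrite -E1 !(unidiag_powR_mul _ _ Vu s0); apply: eq_unidiag => a.
  by rewrite addrC.
move: E1 E2.
move: (unidiag V (fun a => s a `^ (1 / 2)))
  (unidiag V (fun a => s a `^ (- (1 / hat p) / 2)))
  (unidiag V (fun a => s a `^ ((1 / p) / 2))) (unidiag U _) => A B D Y E1 E2.
transitivity (\tr ((A *m B) *m Y *m (B *m A) *m L X)); first by rewrite !mulmxA.
by rewrite E1 E2 -!mulmxA mxtrace_mulC !mulmxA.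
Qed.

Section Dirichlet.
Variables (U : M) (z : 'I_n -> R).
Hypotheses (Uu : U \is unitarymx) (z0 : forall k, 0 < z k).
(** The observable whose noncommutative density with respect to [sigma], in the
    symmetric embedding of exponent [1/2], is the square root of the state with
    eigenvalues [z]. *)
Let Z := Gamma sigma (- (1 / 2)) (unidiag U (fun k => z k `^ (1 / 2))).
Let N := \sum_k z k.
Let m := \sum_a \sum_b overlap U V a b * (s a `^ (1 / 2) * z b `^ (1 / 2)).
Let S t := unidiag V (fun a => s a `^ t).
Let H := unidiag U (fun k => z k `^ (1 / 2)).

Let ZE : Z = S (- (1 / 2 / 2)) *m H *m S (- (1 / 2 / 2)).
Proof. by rewrite /Z (Gamma_unidiag _ _ _ Vu) mulNr. Qed.

Let SS t u : S t *m S u = S (t + u).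
Proof. exact: (unidiag_powR_mul _ _ Vu s0). Qed.

Lemma dirichlet_formE : kms_inner sigma Z (L Z) = sv_form V U s z L (1 / 2).
Proof.
have half : 1 - 1 / 2 = 1 / 2 :> R by field.
rewrite /sv_form half -/H -/(S _) -/(S _) -ZE /kms_inner /sigma.
rewrite (mxpow_unidiag _ _ Vu) -/(S _).
have -> : Z^t* = Z by exact: (Gamma_adj _ _ Vu (unidiag_adj _ _)).
rewrite {1}ZE.
have E : S (1 / 2) *m S (- (1 / 2 / 2)) = S (1 / 2 / 2).
  by rewrite SS; apply: eq_unidiag => a; congr (_ `^ _); field.
have E' : S (- (1 / 2 / 2)) *m S (1 / 2) = S (1 / 2 / 2).
  by rewrite SS addrC -SS E.
move: (S (1 / 2)) (S (- (1 / 2 / 2))) (S (1 / 2 / 2)) E E' => A B D E E'.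
transitivity (\tr ((A *m B) *m H *m (B *m A) *m L Z)); first by rewrite !mulmxA.
by rewrite E E' -!mulmxA mxtrace_mulC !mulmxA.
Qed.

Let sigmaE : sigma = S 1.
Proof. by apply: eq_unidiag => a; rewrite powRr1// ltW. Qed.

Let meanE : \tr (sigma *m Z) = m%:C.
Proof.
have E : S (- (1 / 2 / 2)) *m sigma *m S (- (1 / 2 / 2)) = S (1 / 2).
  by rewrite sigmaE !SS; apply: eq_unidiag => a; congr (_ `^ _); field.
rewrite /m -mxtrace_unidiag_mul -/H -/(S _) -E ZE.
move: sigma (S (- (1 / 2 / 2))) H => A B D.
by rewrite !mulmxA mxtrace_mulC !mulmxA.
Qed.

Let varianceE : normp sigma 2 (Z - (\tr (sigma *m Z))%:M) ^+ 2 = N - m ^+ 2.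
Proof.
rewrite meanE normp2_sqr.
have -> : Gamma sigma (1 / 2) (Z - (m%:C)%:M) = H - m%:C *: S (1 / 2).
  have -> : H = Gamma sigma (1 / 2) Z.
    by rewrite /Z (GammaD _ _ _ Vu s0) subrr (Gamma0 _ _ Vu).
  have -> : S (1 / 2) = S (1 / 2 / 2) *m S (1 / 2 / 2) by rewrite SS -splitr.
  rewrite !(Gamma_unidiag _ _ _ Vu) -/(S _).
  move: (S (1 / 2 / 2)) Z => A B.
  by rewrite mulmxBr mulmxBl mul_mx_scalar -scalemxAl.
have Hadj : H^t* = H by exact: unidiag_adj.
have Sadj : (S (1 / 2))^t* = S (1 / 2) by exact: unidiag_adj.
have HH : \tr (H *m H) = N%:C.
  rewrite /H (unidiag_mul _ _ Uu) (mxtrace_unidiag _ Uu); congr (_%:C).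
  apply: eq_bigr => k _; rewrite -powRD ?(gt_eqF (z0 k)) ?implybT//.
  by rewrite -splitr powRr1// ltW.
have SH : \tr (S (1 / 2) *m H) = m%:C by rewrite mxtrace_unidiag_mul.
have S2 : \tr (S (1 / 2) *m S (1 / 2)) = 1.
  by rewrite SS -splitr -sigmaE (mxtrace_unidiag _ Vu) s1.
move: SH S2 HH Hadj Sadj; move: (S (1 / 2)) H => A B SH S2 HH Badj Aadj.
rewrite adjmxB adjmxZ conj_real_complex Badj Aadj.
rewrite mxtrace_sqr_sub SH S2 HH.
rewrite -[RHS]/(complex.Re (N - m ^+ 2)%:C); congr complex.Re.
by rewrite rmorphB rmorphXn /=; ring.
Qed.

Lemma poincare_dirichlet (lam : R) :
  (lam%:E <= poincare_constant sigma L)%E -> m ^+ 2 <= N ->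
  0 <= - complex.Re (sv_form V U s z L (1 / 2)) ->
  lam * (N - m ^+ 2) <= - complex.Re (sv_form V U s z L (1 / 2)).
Proof.
move=> lam_le mN; rewrite -dirichlet_formE -varianceE => E0.
(* Scalars are excluded from the infimum; for them the variance vanishes. *)
have [/is_scalar_mxP[c Zc]|Zns] := boolP (is_scalar_mx Z).
  have -> : Z - (\tr (sigma *m Z))%:M = 0.
    rewrite Zc mul_mx_scalar mxtraceZ (mxtrace_unidiag _ Vu) s1 mulr1.
    exact: subrr.
  suff -> : normp sigma 2 (0 : M) ^+ 2 = 0 by rewrite mulr0.
  rewrite normp2_sqr (_ : Gamma _ _ 0 = 0) ?mulmx0 ?mxtrace0//.
  by rewrite /Gamma mulmx0 mul0mx.
have : (poincare_constant sigma L <= (- complex.Re (kms_inner sigma Z (L Z)) /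
    normp sigma 2 (Z - (\tr (sigma *m Z))%:M) ^+ 2)%:E)%E.
  by apply: ereal_inf_lbound; exists Z.
move=> /(le_trans lam_le); rewrite lee_fin => le_quot.
have V0 : 0 <= normp sigma 2 (Z - (\tr (sigma *m Z))%:M) ^+ 2.
  by rewrite varianceE subr_ge0.
move: V0; rewrite le_eqVlt => /orP[/eqP<-|V0]; first by rewrite mulr0.
by rewrite -ler_pdivlMr.
Qed.

End Dirichlet.

(** The state [tau] has eigenvalues [z = y^p]; the norm [normp sigma 1 X] is the
    moment [tr (sigma^(1-1/p) tau^(1/p))] since it is the trace of the positive
    matrix [Gamma^1 X = Gamma^(1-1/p) Y]. *)
Lemma beckner_of_poincare (smin lam : R) :
  0 < smin -> (forall a, smin <= s a) ->
  (lam%:E <= poincare_constant sigma L)%E ->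
  beckner sigma L p
    (Num.max (1 / (2 * p * (2 - ln smin))) ((p - 1) / p) * lam).
Proof.
move=> smin0 smin_le lam_le X Xpos.
have lns : 0 < 2 - ln smin.
  by rewrite subr_gt0 (le_lt_trans (ln_le0 (lower_bound_le1 smin_le))).
have [[U y] /= [Uu y0] XE] :=
  posdefmx_unidiag (posdefmx_Gamma (1 / p) Vu s0 Xpos).
have [[U1 y1] /= [U1u y10] X1E] :=
  posdefmx_unidiag (posdefmx_Gamma (1 / 1) Vu s0 Xpos).
pose z k := y k `^ p; have z0 k : 0 < z k by rewrite powR_gt0.
have [] := two_state_comparison Uu z0 smin0 smin_le.
set m := \sum_a _; set q := \sum_a _; set N := \sum_k _.
move=> mq qN qdef.
have yz k : z k `^ (1 / p) = y k.
  by rewrite /z -powRrM mul1r divff ?gt_eqF// powRr1 ?ltW.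
have normp_p : normp sigma p X `^ p = N.
  by apply: (normp_powR Uu _ p_gt0 XE) => k; exact: ltW.
have normp_1 : normp sigma 1 X = q.
  rewrite -[LHS]powRr1 ?powR_ge0// (normp_powR U1u (fun k => ltW (y10 k)) ltr01 X1E).
  under eq_bigr do rewrite powRr1 ?ltW//.
  apply: (@complexI R); rewrite -(mxtrace_unidiag _ U1u) -X1E.
  have -> : q%:C = \tr (unidiag V (fun a => s a `^ (1 - 1 / p)) *m
      unidiag U (fun k => z k `^ (1 / p))).
    by rewrite mxtrace_unidiag_mul.
  rewrite (eq_unidiag U yz) -XE.
  have -> : Gamma (unidiag V s) (1 / 1) X =
      Gamma (unidiag V s) (1 - 1 / p) (Gamma sigma (1 / p) X).
    by rewrite (GammaD _ _ _ Vu s0) subrK divr1.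
  rewrite [LHS](congr1 mxtrace (Gamma_unidiag _ _ _ Vu)) XE.
  have -> : unidiag V (fun a => s a `^ (1 - 1 / p)) =
      unidiag V (fun a => s a `^ ((1 - 1 / p) / 2)) *m
      unidiag V (fun a => s a `^ ((1 - 1 / p) / 2)).
    by rewrite (unidiag_powR_mul _ _ Vu s0) -splitr.
  move: (unidiag V _) (unidiag U _) => A B.
  by rewrite mxtrace_mulC mulmxA.
have subst (k a a' b b' e e' : R) : a = a' -> b = b' -> e = e' ->
    k * (a' - b') <= e' -> k * (a - b) <= e by move=> -> -> ->.
apply: (subst _ _ _ _ _ _ _ normp_p (congr1 (fun x => x `^ p) normp_1)
  (beckner_energyE Uu y0 XE)).
have t01 : 1 / 2 <= 1 / p <= 1.
  case/andP: p12 => ? ?.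
  by apply/andP; split; rewrite !div1r ?lef_pV2 ?posrE// invf_le1// ltW.
have [D0 SV] := stroock_varopoulos Vu Uu s0 z0 L_adj L1 L_ccp L_gns t01.
have PD := poincare_dirichlet Uu z0 lam_le (le_trans mq qN) D0.
rewrite mulNr -mulrN; exact: (beckner_arithmetic p12 lns mq qN qdef D0 SV PD).
Qed.

End BecknerFromPoincare.

(** * Eigenvalues of the invariant state *)

Section Spectrum.
Context {R : realType} {n : nat}.
Local Notation M := 'M[R[i]]_n.
Implicit Types (V : M) (s : 'I_n -> R).

Lemma eigenvalue_unidiag V s a : V \is unitarymx ->
  eigenvalue (unidiag V s) (s a)%:C.
Proof.
move=> Vu; apply/eigenvalueP; exists ((eigvec V a)^t*).
  rewrite -[unidiag V s]unidiag_adj -adjmxM (unidiag_eigvec Vu) adjmxZ.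
  by rewrite conj_real_complex.
apply/eqP => E; have := eigvec_dot V V a a.
rewrite E mul0mx (unitary_mul_adj Vu) => /matrixP/(_ 0 0).
by rewrite !mxE !eqxx => /esym/eqP; rewrite oner_eq0.
Qed.

Lemma eigenvalue_unidiag_inv V s c : V \is unitarymx ->
  eigenvalue (unidiag V s) c -> exists a, c = (s a)%:C.
Proof.
move=> Vu /eigenvalueP[v vE v0].
have wE : v *m V^t* *m diagR s = c *: (v *m V^t*).
  have := congr1 (fun x => x *m V^t*) vE.
  rewrite /unidiag; move: (diagR s) => D.
  by rewrite !mulmxA -[_ *m V *m V^t*]mulmxA (unitary_mul_adj Vu) mulmx1 -scalemxAl.
have [a wa] : exists a, (v *m V^t*) 0 a != 0.
  apply: contrapT => H; case/eqP: v0.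
  rewrite -[v]mulmx1 -(unitary_adj_mul Vu) mulmxA (_ : v *m V^t* = 0) ?mul0mx//.
  apply/rowP => a; rewrite [RHS]mxE; apply/eqP; apply: contrapT => /negP wa.
  by apply: H; exists a.
exists a; apply: (mulfI wa).
have := congr1 (fun x : 'rV[R[i]]_n => x 0 a) wE.
by rewrite mul_mx_diag !mxE => E; rewrite mulrC -E.
Qed.

(** Invertibility excludes the eigenvalue [0] of a positive semidefinite
    matrix. *)
Lemma psdmx_unit_gt0 V s : V \is unitarymx -> psdmx (unidiag V s) ->
  unidiag V s \in unitmx -> forall a, 0 < s a.
Proof.
move=> Vu psd unit a; rewrite lt_neqAle (psdmx_unidiag_ge0 a Vu psd) andbT.
apply/eqP => sa; have := eigvec_dot V V a a.
have -> : eigvec V a = 0.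
  by rewrite -(mulKmx unit (eigvec V a)) (unidiag_eigvec Vu) -sa scale0r mulmx0.
rewrite mulmx0 (unitary_mul_adj Vu) => /matrixP/(_ 0 0).
by rewrite !mxE !eqxx => /esym/eqP; rewrite oner_eq0.
Qed.

End Spectrum.

Unset Implicit Arguments.

Theorem theorem3p20 (R : realType) (n : nat)
    (P : R -> 'M[R[i]]_n -> 'M[R[i]]_n) (L : 'M[R[i]]_n -> 'M[R[i]]_n)
    (sigma : 'M[R[i]]_n) (sigma_min : R)
    (hP : is_qms P) (hL : is_generator P L)
    (hprim : primitive_for P sigma)
    (hgns : gns_detailed_balance sigma L)
    (hmin : smallest_eigenvalue sigma sigma_min)
    (p : R) (hp : 1 < p <= 2) :
  ((Num.max (1 / (2 * p * (2 - ln sigma_min))) ((p - 1) / p))%:E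
     * poincare_constant sigma L
   <= beckner_constant sigma L p)%E.
Proof.
pose Llin : {linear 'M[R[i]]_n -> 'M[R[i]]_n} :=
  HB.pack L (GRing.isLinear.Build _ _ _ _ L (generator_linear hP hL)).
have [[[sigma_psd sigma_tr] _] _ sigma_rank] := hprim.
have Vu := spectral_unitarymx sigma.
have := hermitian_unidiag (psdmx_adj sigma_psd).
move: (spectralmx sigma) (fun i => _) Vu => V s Vu sigmaE.
subst sigma.
have unit : unidiag V s \in unitmx by rewrite -row_free_unit /row_free sigma_rank.
have s0 := psdmx_unit_gt0 Vu sigma_psd unit.
have s1 : \sum_a s a = 1.
  by apply: (@complexI R); rewrite -(mxtrace_unidiag _ Vu).
have [smin_ev smin_le] := hmin.
have smin_le' a : sigma_min <= s a.
  by rewrite -lecR; apply: smin_le; exact: eigenvalue_unidiag.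
have smin0 : 0 < sigma_min.
  by have [a [->]] := eigenvalue_unidiag_inv Vu smin_ev.
(* Quantifying over all real lower bounds also covers an infinite Poincare
   constant, which occurs in dimension one. *)
have main (lam : R) : (lam%:E <= poincare_constant (unidiag V s) L)%E ->
    ((Num.max (1 / (2 * p * (2 - ln sigma_min))) ((p - 1) / p) * lam)%:E
      <= beckner_constant (unidiag V s) L p)%E.
  move=> lam_le; apply: ereal_sup_ubound; eexists; last reflexivity.
  exact: (@beckner_of_poincare R n V s Llin p Vu s0 s1 (generator_adj hP hL)
    (generator1 hP hL) (generator_conditionally_cp hP hL) hgns hp _ lam smin0).
have K0 : 0 < Num.max (1 / (2 * p * (2 - ln sigma_min))) ((p - 1) / p).
  case/andP: hp => p1 _; rewrite lt_max; apply/orP; right.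
  by rewrite divr_gt0 ?subr_gt0// (lt_trans _ p1).
move: main; move: (Num.max _ _) K0 (poincare_constant _ _) (beckner_constant _ _ _).
move=> K K0 [lam| |] b main.
- by rewrite -EFinM; exact: main.
- rewrite gt0_muley ?lte_fin//.
  case: b main => [b| |] main //; last by have := main 0 (leey _).
  have := main ((b + 1) / K) (leey _).
  by rewrite lee_fin mulrC divfK ?gt_eqF// gerDl ler10.
- by rewrite gt0_muleNy ?lte_fin// leNye.
Qed.
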